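(* Let $C_0,C_1$ be unoriented generic closed plane curves in general position, let $\Gamma$ be a bridge between them with endpoints $b_i\in C_i$ ($i=0,1$), and let $c_0,c_1$ be parameters of $C_0,C_1$ that are compatible with respect to $\Gamma$. Let $p_1,\dots,p_k$ (resp. $q_1,\dots,q_l$) be the double points of $C_0$ (resp. $C_1$), let $R_1^j$ be the connected component of $\mathbb{R}^2\setminus C_1$ that contains $p_j$, and let $R_0^m$ be the connected component of $\mathbb{R}^2\setminus C_0$ that contains $q_m$. Then $$T^{\mathit{St}}_{\Gamma}(C_0,C_1)=\sum_{1\le j\le k}e^{c_0}_{b_0}(p_j)\,\mathrm{ind}^{R_1^j}(c_1)+\sum_{1\le m\le l}e^{c_1}_{b_1}(q_m)\,\mathrm{ind}^{R_0^m}(c_0).$$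
   Context: **Curves.** $S^1=\mathbb{R}/\mathbb{Z}$. A generic plane curve is a $C^\infty$-immersion $c\colon M\to\mathbb{R}^2$ ($M=S^1$ or a closed interval) with no self-tangency points and no multiple points of multiplicity $\ge 3$; its image $C=c(M)$ is an unoriented generic plane curve, and a parameter of $C$ is such an immersion with image $C$. $D(C)$ denotes the set of double points of $C$. **Bridges.** Generic closed curves are in general position if there is no tangency or triple point involving both. A bridge between $C_0$ and $C_1$ is the image $\Gamma=\gamma([0,1])$ of a generic curve with $b_i:=\gamma(i)\in C_i$, $\Gamma\cap D(C_i)=\emptyset$, $D(\Gamma)\cap C_i=\emptyset$ ($i=0,1$), $\Gamma\cap C_0\cap C_1=\emptyset$, and $\Gamma$ transverse to $C_0$ and $C_1$ (also at the endpoints). The generalized connected sum $C_0+_\Gamma C_1$ is obtained by removing from each $C_i$ a small interval $I_i$ around $b_i$ (meeting $\Gamma$ only at $b_i$, containing no double point of $C_i$ and no point of $C_{1-i}$) and adding two curves $\Gamma_\pm$ parallel to and sufficiently close to $\Gamma$ joining the endpoints of $I_0$ to those of $I_1$, with corners smoothed; it is a generic closed curve. Parameters $c_0,c_1$ of $C_0,C_1$ are compatible with respect to $\Gamma$ if some parameter of $C_0+_\Gamma C_1$ induces on $C_i$ the orientation of $c_i$ for both $i=0,1$. **Index.** For a component $R$ of $\mathbb{R}^2\setminus C$, $\mathrm{ind}^R(c)$ is the winding number of $c$ around a point of $R$. **The sign $e$.** For a generic closed curve $c$, a non-double point $x=c(t_0)$ and a double point $p=c(t_1)=c(t_2)$ with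 $t_0<t_1<t_2<1+t_0$, put $e^c_x(p)=+1$ (resp. $-1$) if $(c'(t_1),c'(t_2))$ is a positive (resp. negative) basis of $\mathbb{R}^2$. **Sign of a triple point crossing.** When a homotopy crosses a generic triple point (pairwise transverse branches), a small triangle formed by the three branches vanishes and a new one (the newborn triangle) appears. The parameter of the curve gives a cyclic order to the three edges of the newborn triangle (the order of visits), hence an orientation of its boundary; let $q$ be the number of edges whose orientation as pieces of the parametrized curve agrees with that boundary orientation. The sign of the newborn triangle is $(-1)^q$. **$T^{\mathit{St}}_\Gamma$.** Closed curves are separated if each lies in the unbounded component of the complement of the other. A generic separating homotopy of $C_0$ from $C_1$ is a regular homotopy of $C_0$ through generic closed curves (essentially a translation) ending at a curve separated from $C_1$, such that the moving curve and $C_1$ are in general position except at finitely many instants, where there is exactly one generic (quadratic) tangency or generic triple point involving both. $T^{\mathit{St}}_\Gamma(C_0,C_1)$ is the number of triple points occurring in such a homotopy counted with the signs $(-1)^q$ of the newborn triangles, where the sign is determined by extending the homotopy to one of $C_0+_\Gamma C_1$ (so for compatible parameters $c_0,c_1$ the cyclic order of edges is the order of visits when one first traverses $c_0$ starting and ending at $b_0$ and then $c_1$ starting and ending at $b_1$). It does not depend on the choices. *)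

(* Defs.v *)
From HB Require Import structures.
From mathcomp Require Import all_boot all_order all_algebra.
From mathcomp Require Import all_classical all_reals all_analysis.

Set Implicit Arguments.
Unset Strict Implicit.
Unset Printing Implicit Defensive.
Import Order.TTheory GRing.Theory Num.Theory.
Import numFieldNormedType.Exports.
Local Open Scope classical_set_scope.
Local Open Scope ring_scope.

Notation plane R := (R * R)%type (only parsing).

Definition det2 (R : realType) (v w : plane R) : R := v.1 * w.2 - v.2 * w.1.

Definition smooth_curve (R : realType) (c : R -> plane R) : Prop :=
  forall (n : nat) (t : R), derivable (derive1n n c) t 1.

(* A map S^1 = R/Z -> R^2 is a 1-periodic function on R; two parameters denote
   the same point of S^1 when their difference is an integer. *)
Definition same_param (R : realType) (s t : R) : Prop := s - t \is a Num.int.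

Definition generic_closed_curve (R : realType) (c : R -> plane R) : Prop :=
  [/\ smooth_curve c,
      forall t, c (t + 1) = c t,
      forall t, derive1 c t != 0,
      forall s t, ~ same_param s t -> c s = c t ->
        det2 (derive1 c s) (derive1 c t) != 0
    & forall r s t, ~ same_param r s -> ~ same_param s t -> ~ same_param r t ->
        ~ (c r = c s /\ c s = c t)].

Definition double_points (R : realType) (c : R -> plane R) : set (plane R) :=
  [set x | exists s t, [/\ ~ same_param s t, c s = x & c t = x]].

Definition arc_image (R : realType) (g : R -> plane R) : set (plane R) :=
  g @` `[0, 1].

(* A generic curve on [0, 1] is given by a smooth extension to R (a smooth map
   on a closed interval always has one); only its values on [0, 1] matter. *)
Definition generic_arc (R : realType) (g : R -> plane R) : Prop :=
  [/\ smooth_curve g,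
      forall t, t \in `[0, 1] -> derive1 g t != 0,
      forall s t, s \in `[0, 1] -> t \in `[0, 1] -> s != t -> g s = g t ->
        det2 (derive1 g s) (derive1 g t) != 0
    & forall r s t, r \in `[0, 1] -> s \in `[0, 1] -> t \in `[0, 1] ->
        r != s -> s != t -> r != t -> ~ (g r = g s /\ g s = g t)].

Definition arc_double_points (R : realType) (g : R -> plane R) :
    set (plane R) :=
  [set x | exists s t, [/\ s \in `[0, 1], t \in `[0, 1], s != t, g s = x
                         & g t = x]].

Definition tangency (R : realType) (c0 c1 : R -> plane R) (s t : R) : Prop :=
  c0 s = c1 t /\ det2 (derive1 c0 s) (derive1 c1 t) = 0.

Definition no_tangency (R : realType) (c0 c1 : R -> plane R) : Prop :=
  forall s t, ~ tangency c0 c1 s t.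

Definition general_position (R : realType) (c0 c1 : R -> plane R) : Prop :=
  [/\ no_tangency c0 c1,
      double_points c0 `&` range c1 = set0
    & range c0 `&` double_points c1 = set0].

(* A pair of curves indexed by bool: false stands for 0 and true for 1. *)
Definition two (T : Type) (x0 x1 : T) (i : bool) : T := if i then x1 else x0.

Definition bridge (R : realType) (c : bool -> R -> plane R)
    (g : R -> plane R) : Prop :=
  generic_arc g /\
  [/\ forall i : bool, range (c i) (g i%:R),
      forall i : bool, arc_image g `&` double_points (c i) = set0,
      forall i : bool, arc_double_points g `&` range (c i) = set0,
      arc_image g `&` range (c false) `&` range (c true) = set0
    & forall (i : bool) (s t : R), s \in `[0, 1] -> g s = c i t ->
        det2 (derive1 g s) (derive1 (c i) t) != 0].

(* Choices made in the construction of a generalized connected sum: the removed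
   interval I_i is c_i([lo i, hi i]); side true and side false are the curves
   Gamma_+ and Gamma_-, running on the left and on the right of Gamma; the four
   corners are smoothed in the balls of radius rad around them. *)
Record sum_data (R : realType) := SumData {
  lo : bool -> R;
  hi : bool -> R;
  side : bool -> R -> plane R;
  rad : R }.

Definition removed (R : realType) (c : bool -> R -> plane R) (d : sum_data R)
    (i : bool) : set (plane R) :=
  c i @` `[lo d i, hi d i].

Definition corners (R : realType) (c : bool -> R -> plane R) (d : sum_data R)
    (i : bool) : set (plane R) :=
  [set c i (lo d i); c i (hi d i)].

Definition corner_balls (R : realType) (c : bool -> R -> plane R)
    (d : sum_data R) : set (plane R) :=
  [set y | exists i x, corners c d i x /\ `|y - x| <= rad d].

Definition simple_arc (R : realType) (A : set (plane R)) : Prop :=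
  exists a : R -> plane R,
    [/\ smooth_curve a, forall t, t \in `[0, 1] -> derive1 a t != 0,
        {in `[0, 1] &, injective a} & a @` `[0, 1] = A].

Definition valid_intervals (R : realType) (eps : R) (c : bool -> R -> plane R)
    (g : R -> plane R) (d : sum_data R) : Prop :=
  forall i : bool,
  [/\ exists t, lo d i < t < hi d i /\ c i t = g i%:R,
      hi d i < lo d i + 1 /\ (forall x, removed c d i x -> `|x - g i%:R| < eps),
      removed c d i `&` arc_image g = [set g i%:R],
      removed c d i `&` double_points (c i) = set0
    & removed c d i `&` range (c (~~ i)) = set0].

Definition valid_sides (R : realType) (eps : R) (c : bool -> R -> plane R)
    (g : R -> plane R) (d : sum_data R) : Prop :=
  [/\ forall b, smooth_curve (side d b),
      forall b t, t \in `[0, 1] ->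
        `|side d b t - g t| < eps /\
        `|derive1 (side d b) t - derive1 g t| < eps,
      forall t, t \in `[0, 1] ->
        det2 (derive1 g t) (side d false t - g t) < 0
        < det2 (derive1 g t) (side d true t - g t)
    & forall i : bool,
        [set side d false i%:R; side d true i%:R] = corners c d i].

(* k parametrizes a connected sum C_0 +_Gamma C_1 whose construction takes place
   within distance eps: its image is the union of the C_i minus I_i and of
   Gamma_+, Gamma_-, except that each of the four corners is replaced by a
   smooth simple arc. *)
Definition connected_sum (R : realType) (eps : R) (c : bool -> R -> plane R)
    (g : R -> plane R) (d : sum_data R) (k : R -> plane R) : Prop :=
  [/\ valid_intervals eps c g d,
      valid_sides eps c g d,
      0 < rad d < eps /\
      (forall i j x y, corners c d i x -> corners c d j y -> x <> y ->
         2 * rad d < `|x - y|),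
      generic_closed_curve k
    & range k `\` corner_balls c d =
        ((range (c false) `\` removed c d false)
         `|` (range (c true) `\` removed c d true)
         `|` arc_image (side d false) `|` arc_image (side d true))
        `\` corner_balls c d
      /\ (forall i x, corners c d i x ->
            simple_arc (range k `&` [set y | `|y - x| <= rad d]))].

Definition induces_orientations (R : realType) (c : bool -> R -> plane R)
    (d : sum_data R) (k : R -> plane R) : Prop :=
  forall (i : bool) (t : R),
    ~ removed c d i (c i t) -> ~ corner_balls c d (c i t) ->
    exists u a, [/\ 0 < a, k u = c i t & derive1 k u = a *: derive1 (c i) t].

(* "Sufficiently close": for arbitrarily thin connected sums. *)
Definition compatible (R : realType) (c : bool -> R -> plane R)
    (g : R -> plane R) : Prop :=
  forall eps : R, 0 < eps ->
  exists d k, connected_sum eps c g d k /\ induces_orientations c d k.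

(* n is the winding number of c around x, read off a continuous determination
   theta of the argument of c - x. *)
Definition is_winding_number (R : realType) (c : R -> plane R) (x : plane R)
    (n : int) : Prop :=
  exists theta : R -> R,
    [/\ continuous theta,
        forall t, exists r : R,
          0 < r /\ c t - x = (r * cos (theta t), r * sin (theta t))
      & theta 1 - theta 0 = 2 * pi * n%:~R].

Definition component_of (R : realType) (c : R -> plane R) (x : plane R) :
    set (plane R) :=
  connected_component (~` range c) x.

Definition ind (R : realType) (A : set (plane R)) (c : R -> plane R) : int :=
  xget 0 [set n | exists x, A x /\ is_winding_number c x n].

Definition e_sign (R : realType) (c : R -> plane R) (x p : plane R) : int :=
  xget 0 [set e | exists t0 t1 t2,
    [/\ [/\ t0 < t1, t1 < t2 & t2 < 1 + t0],
        c t0 = x, c t1 = p, c t2 = p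
      & e = sgz (det2 (derive1 c t1) (derive1 c t2))]].

Definition separated_curves (R : realType) (c0 c1 : R -> plane R) : Prop :=
  (forall x, range c0 x ->
     (~` range c1) x /\ ~ bounded_set (component_of c1 x)) /\
  (forall x, range c1 x ->
     (~` range c0) x /\ ~ bounded_set (component_of c0 x)).

(* A quadratic tangency: the contact is of order exactly two, that is, the
   curvatures of the two branches differ. *)
Definition quadratic_tangency (R : realType) (c0 c1 : R -> plane R)
    (s t : R) : Prop :=
  exists a : R, derive1 c0 s = a *: derive1 c1 t /\
    det2 (derive1 c0 s) (derive1n 2 c0 s - a ^+ 2 *: derive1n 2 c1 t) != 0.

Definition only_quadratic_tangency (R : realType) (c0 c1 : R -> plane R) :
    Prop :=
  exists s t,
    [/\ tangency c0 c1 s t, quadratic_tangency c0 c1 s t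
      & forall s' t', tangency c0 c1 s' t' ->
          same_param s' s /\ same_param t' t].

(* A visit (i, t) is the passage of the curve c_i at parameter t. With t in
   [b_i, b_i + 1[, where c_i(b_i) is the endpoint of the bridge on C_i, visits
   are ordered by traversing first c_0 from b_0 to b_0, then c_1 from b_1 to
   b_1. *)
Definition visit_lt (R : realType) (v w : bool * R) : Prop :=
  (v.1 = false /\ w.1 = true) \/ (v.1 = w.1 /\ v.2 < w.2).

(* Three successive visits, not all of the same curve, of a common point. *)
Definition triple_point (R : realType) (c : bool -> R -> plane R)
    (b : bool -> R) (v : 'I_3 -> bool * R) : Prop :=
  [/\ forall i, b (v i).1 <= (v i).2 < b (v i).1 + 1,
      forall i j : 'I_3, (i < j)%N -> visit_lt (v i) (v j),
      forall i j, c (v i).1 (v i).2 = c (v j).1 (v j).2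
    & exists i j, (v i).1 != (v j).1].

Definition transverse_branches (R : realType) (c : bool -> R -> plane R)
    (v : 'I_3 -> bool * R) : Prop :=
  forall i j, i != j ->
    det2 (derive1 (c (v i).1) (v i).2) (derive1 (c (v j).1) (v j).2) != 0.

(* A triangle formed by the three branches of c at the visits v, within eps of
   v. The edges are numbered cyclically (index addition in 'I_3 is modulo 3) in
   the order of visits, and the boundary of the triangle is oriented
   accordingly: edge i goes from parameter x i (its common vertex with edge
   i - 1) to parameter y i (its common vertex with edge i + 1). *)
Definition triangle (R : realType) (eps : R) (c : bool -> R -> plane R)
    (v : 'I_3 -> bool * R) (x y : 'I_3 -> R) : Prop :=
  forall i : 'I_3,
    [/\ `|x i - (v i).2| < eps, `|y i - (v i).2| < eps, x i != y i
      & c (v i).1 (y i) = c (v (i + 1)).1 (x (i + 1))].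

Definition agreeing_edges (R : realType) (x y : 'I_3 -> R) : {set 'I_3} :=
  [set i : 'I_3 | x i < y i]%SET.

(* c u is the pair of curves at time u. As u crosses u0, a small triangle
   vanishes at the triple point v and a newborn one appears, whose edges
   agreeing with the orientation of its boundary are those in A; in the
   vanishing triangle all orientations are opposite (otherwise the triple point
   would be touched and not crossed). *)
Definition triple_crossing (R : realType) (c : R -> bool -> R -> plane R)
    (u0 : R) (v : 'I_3 -> bool * R) (A : {set 'I_3}) : Prop :=
  forall eps : R, 0 < eps ->
    (\forall u \near u0^'-, exists x y,
       triangle eps (c u) v x y /\ agreeing_edges x y = (~: A)%SET) /\
    (\forall u \near u0^'+, exists x y,
       triangle eps (c u) v x y /\ agreeing_edges x y = A).

(* The pair (H u, c1) at time u, with its starting parameters: the starting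
   point of H u follows the homotopy, that of c1 is fixed. *)
Definition moving (R : realType) (H : R -> R -> plane R) (c1 : R -> plane R)
    (u : R) : bool -> R -> plane R := two (H u) c1.

Definition moving_base (R : realType) (b : R -> R) (b1 : R) (u : R) :
    bool -> R := two (b u) b1.

Definition regular_homotopy (R : realType) (H : R -> R -> plane R) : Prop :=
  [/\ forall u, u \in `[0, 1] -> generic_closed_curve (H u),
      {within [set z : R * R | z.1 \in `[0, 1]],
         continuous (fun z : R * R => H z.1 z.2)}
    & {within [set z : R * R | z.1 \in `[0, 1]],
         continuous (fun z : R * R => derive1 (H z.1) z.2)}].

(* H is a generic separating homotopy of C_0 from C_1, extended to C_0 +_Gamma C_1
   as far as the endpoint H u (b u) of the bridge on the moving curve is
   concerned: as for any bridge, this endpoint is never a double point. *)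
Definition generic_separating_homotopy (R : realType) (c0 c1 : R -> plane R)
    (b0 b1 : R) (H : R -> R -> plane R) (b : R -> R) : Prop :=
  [/\ regular_homotopy H /\ H 0 = c0,
      separated_curves (H 1) c1,
      [/\ {within `[0, 1], continuous b}, b 0 = b0
        & forall u, u \in `[0, 1] -> ~ double_points (H u) (H u (b u))],
      finite_set [set u | u \in `[0, 1] /\ ~ general_position (H u) c1]
    & forall u, u \in `[0, 1] -> ~ general_position (H u) c1 ->
        (only_quadratic_tangency (H u) c1 /\
         forall v, ~ triple_point (moving H c1 u) (moving_base b b1 u) v)
        \/
        (no_tangency (H u) c1 /\
         exists v,
           [/\ triple_point (moving H c1 u) (moving_base b b1 u) v,
               forall w, triple_point (moving H c1 u) (moving_base b b1 u) w ->
                 w = v,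
               transverse_branches (moving H c1 u) v
             & exists A, triple_crossing (moving H c1) u v A])].

(* The sign (-1)^q of the newborn triangle at a time u at which H goes through a
   triple point with c1, and 0 at the other times. *)
Definition newborn_sign (R : realType) (c1 : R -> plane R) (b1 : R)
    (H : R -> R -> plane R) (b : R -> R) (u : R) : int :=
  xget 0 [set e | exists v A,
    [/\ triple_point (moving H c1 u) (moving_base b b1 u) v,
        triple_crossing (moving H c1) u v A & e = (-1) ^+ #|A|]].

(* T is the value T^St_Gamma(C_0, C_1) of the signed count of triple points,
   computed with the parameters c0, c1, compatible with respect to Gamma. *)
Definition is_TSt (R : realType) (c0 c1 g : R -> plane R) (T : int) : Prop :=
  exists (b0 b1 : R) (H : R -> R -> plane R) (b : R -> R),
    [/\ c0 b0 = g 0, c1 b1 = g 1,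
        generic_separating_homotopy c0 c1 b0 b1 H b
      & T = \sum_(u \in `[0, 1]) newborn_sign c1 b1 H b u].

(* Main.v *)
Require Import Defs.
From HB Require Import structures.
From mathcomp Require Import all_boot all_order all_algebra.
From mathcomp Require Import all_classical all_reals all_analysis.
From mathcomp Require Import ring lra.
(* Let F(u) be the right-hand side for the pair (H u, c1) at time u of the
   separating homotopy. The separation at time 1 makes all indices vanish, so
   F(1) = 0. Double points are continued by the implicit function theorem and
   indices are locally constant, so F can only change at a triple point, where
   exactly one double point p crosses the other curve. There e(p) is constant
   and the index of p jumps by 1 to the left or to the right; since the newborn
   triangle closes up, the sign of the product is the product of the three signs
   of its edges, that is, -(-1)^q. Summing the jumps gives F(0) = T. *)

Set Implicit Arguments.
Unset Strict Implicit.
Unset Printing Implicit Defensive.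
Import Order.TTheory GRing.Theory Num.Theory.
Import numFieldNormedType.Exports.
Local Open Scope classical_set_scope.
Local Open Scope ring_scope.

(** * Winding numbers *)

Section Argument.
Variable R : realType.
Implicit Types (v w : R * R) (x y t : R) (f h : R -> R * R).

(** The homotopy and its derivative in [t] depend only continuously on the time [u]. Hence a double
    point is continued by a uniform mean value estimate for chords (uniqueness) and by minimising
    the squared distance of two branches (existence). At a triple point no velocity is available
    either: the side on which the double point lies is read off the small triangle itself. Winding
    numbers are handled without integrals. Two vectors with positive dot product differ by an angle
    in ]-pi/2, pi/2[ that depends continuously on them, so arguments can be transported from one
    loop to a close one, and an index can change only where this positivity fails. Every curve is
    reparametrized to start at the endpoint of the bridge. That point is never double, so double
    points correspond to pairs 0 < s < t < 1 that cannot escape through the boundary, and the order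
    s < t, on which the sign e depends, persists in time. A tangency of the two curves leaves F
    unchanged, because F only involves the position of double points relative to the other curve. *)

Definition dot2 v w : R := v.1 * w.1 + v.2 * w.2.

Definition has_arg v x : Prop :=
  exists r : R, 0 < r /\ v = (r * cos x, r * sin x).

(** The oriented angle from [v] to [w] when [dot2 v w] is positive. It involves no choice of a
    branch, which is what makes the transport of arguments continuous. *)
Definition turn v w : R := atan (det2 v w / dot2 v w).

Lemma sin2cos2 x : sin x ^+ 2 = 1 - cos x ^+ 2.
Proof. by rewrite -(cos2Dsin2 x) addrC addKr. Qed.

Lemma cos_atan_gt0 x : 0 < cos (atan x).
Proof. by apply: cos_gt0_pihalf; rewrite atan_gtNpi2 atan_ltpi2. Qed.

Lemma has_arg_turn v w x :
  0 < dot2 v w -> has_arg v x -> has_arg w (x + turn v w).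
Proof.
move=> vw [r [r0 vE]]; set a := turn v w.
have c0 : 0 < cos a by exact: cos_atan_gt0.
have sE : sin a = det2 v w / dot2 v w * cos a.
  rewrite -[X in X * _]atanK -/(turn v w) -/a /tan -mulrA mulVf ?mulr1 //.
  by rewrite gt_eqF.
(* This is the length of [w], solved from the fact that [dot2 v w] is the product of both lengths
   and [cos a]. *)
exists (dot2 v w / (cos a * r)); split; first by rewrite divr_gt0 ?mulr_gt0.
rewrite cosD sinD sE; move: vw; rewrite vE /dot2 /det2 /=.
case: w {vE a c0 sE} (cos a) c0 => w1 w2 c c0 /= vw.
have cs := sin2cos2 x; set C := cos x in vw cs *; set S := sin x in vw cs *.
have dn0 := gt_eqF vw; have rn0 := gt_eqF r0; have cn0 := gt_eqF c0.
have E1 : r * C * w2 - r * S * w1 = r * (C * w2 - S * w1) by ring.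
have E2 : r * C * w1 + r * S * w2 = r * (C * w1 + S * w2) by ring.
rewrite E2 mulf_eq0 rn0 /= in dn0; rewrite E1 E2.
congr pair; field : cs; rewrite ?dn0 ?rn0 ?cn0 //.
Qed.
End Argument.

Section Continuity.
Variables (R : realType) (T : topologicalType).
Implicit Types (t : T) (f h : T -> R * R).

Lemma continuous_fst f t : {for t, continuous f} ->
  {for t, continuous (fun t => (f t).1)}.
Proof.
move=> cf; apply: (@continuous_comp _ _ _ f fst t cf).
by case: (f t) => a b; exact: (@cvg_fst _ _ (nbhs a) (nbhs b)).
Qed.

Lemma continuous_snd f t : {for t, continuous f} ->
  {for t, continuous (fun t => (f t).2)}.
Proof.
move=> cf; apply: (@continuous_comp _ _ _ f snd t cf).
by case: (f t) => a b; exact: (@cvg_snd _ _ (nbhs a) (nbhs b)).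
Qed.

Lemma continuous_dot f h t : {for t, continuous f} -> {for t, continuous h} ->
  {for t, continuous (fun t => dot2 (f t) (h t))}.
Proof.
move=> cf ch.
by apply: cvgD; apply: cvgM; [exact: continuous_fst|exact: continuous_fst|exact: continuous_snd|exact: continuous_snd].
Qed.

Lemma continuous_det f h t : {for t, continuous f} -> {for t, continuous h} ->
  {for t, continuous (fun t => det2 (f t) (h t))}.
Proof.
move=> cf ch.
by apply: cvgB; apply: cvgM; [exact: continuous_fst|exact: continuous_snd|exact: continuous_snd|exact: continuous_fst].
Qed.

Lemma continuous_turn f h t : {for t, continuous f} -> {for t, continuous h} ->
  0 < dot2 (f t) (h t) -> {for t, continuous (fun t => turn (f t) (h t))}.
Proof.
move=> cf ch fh; apply: (@continuous_comp _ _ _ _ (@atan R)); last first.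
  exact: continuous_atan.
apply: cvgM; first exact: continuous_det.
by apply: cvgV; [rewrite gt_eqF|exact: continuous_dot].
Qed.

End Continuity.

Section ArgumentTheory.
Variable R : realType.
Implicit Types (v w : R * R) (x y t : R) (f h : R -> R * R).

Lemma cosD2piz x (n : int) : cos (x + 2 * pi * n%:~R) = cos x.
Proof.
have H y (k : nat) : cos (y + 2 * pi * k%:R) = cos y.
  by rewrite -[RHS](periodicn (@cosD2pi R) k) !mulr2n -mulr_natr; congr cos; ring.
case: n => n; first exact: H.
by rewrite -(H _ n.+1) NegzE; congr cos; rewrite mulrNz -pmulrn; ring.
Qed.

Lemma cos_eq1 x : cos x = 1 -> exists n : int, x = 2 * pi * n%:~R.
Proof.
move=> cx; have p0 := pi_gt0 R; pose n := Num.floor (x / (2 * pi)); exists n.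
have /andP[] := Num.Theory.floor_itv (x / (2 * pi)); rewrite -/n.
rewrite ler_pdivlMr ?ltr_pdivrMr; [|lra|lra]; rewrite intrD => n1 n2.
pose y := x + 2 * pi * (- n)%:~R.
have cy : cos y = 1 by rewrite cosD2piz.
suff : y = 0 by rewrite /y mulrNz; lra.
have yE : y = x - 2 * pi * n%:~R by rewrite /y mulrNz; ring.
have [yp|yp] := leP y pi.
  by apply: cos_inj; rewrite ?in_itv /= ?cos0 //; lra.
suff : 2 * pi - y = 0 by lra.
apply: cos_inj; rewrite ?in_itv /= ?cos0; try lra.
have -> : 2 * pi - y = - y + 2 * pi * 1%:~R by ring.
by rewrite cosD2piz cosN.
Qed.

(** Congruence of arguments modulo 2 pi is expressed as [cos = 1], an equation that combines well
    with continuity. *)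
Lemma has_arg_cosB v x y : has_arg v x -> has_arg v y -> cos (x - y) = 1.
Proof.
move=> [r [r0 ->]] [s [s0]] [] E1 E2.
have E3 : r ^+ 2 = s ^+ 2.
  have -> : r ^+ 2 = (r * cos x) ^+ 2 + (r * sin x) ^+ 2.
    by rewrite !exprMn -mulrDr cos2Dsin2 mulr1.
  by rewrite E1 E2 !exprMn -mulrDr cos2Dsin2 mulr1.
have rs : r = s.
  by move/eqP: E3; rewrite eqf_sqr => /orP[/eqP//|/eqP]; lra.
move: E1 E2; rewrite rs => /(mulfI (lt0r_neq0 s0)) E1 /(mulfI (lt0r_neq0 s0)) E2.
by rewrite cosB E1 E2 -!expr2 cos2Dsin2.
Qed.

Lemma has_arg_ex v : v != 0 -> exists x, has_arg v x.
Proof.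
move=> v0.
have e0 : has_arg (1, 0) (0 : R) by exists 1; rewrite cos0 sin0 !mul1r.
have e1 : has_arg (0, 1) (pi / 2 : R).
  by exists 1; rewrite cos_pihalf sin_pihalf !mul1r.
have e2 : has_arg (-1, 0) (pi : R) by exists 1; rewrite cospi sinpi !mul1r.
have e3 : has_arg (0, -1) (- (pi / 2) : R).
  by exists 1; rewrite cosN sinN cos_pihalf sin_pihalf !mul1r.
case: v v0 => a b v0.
have [a0|a0|a0] := ltgtP a 0.
- by eexists; apply: has_arg_turn e2; rewrite /dot2 /=; lra.
- by eexists; apply: has_arg_turn e0; rewrite /dot2 /=; lra.
have [b0|b0|b0] := ltgtP b 0.
- by eexists; apply: has_arg_turn e3; rewrite /dot2 /=; lra.
- by eexists; apply: has_arg_turn e1; rewrite /dot2 /=; lra.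
by move: v0; rewrite a0 b0 eqxx.
Qed.

(** A continuous function with values in the multiples of 2 pi cannot move: the intermediate value
    theorem would give it a value between two multiples. *)
Lemma cos_eq1_const (a b : R) (d : R -> R) : a <= b ->
  (forall t, a <= t <= b -> {for t, continuous d}) ->
  (forall t, a <= t <= b -> cos (d t) = 1) -> d a = d b.
Proof.
move=> ab cd d1; have p0 := pi_gt0 R.
have ivt (z : R) : Num.min (d a) (d b) <= z <= Num.max (d a) (d b) ->
    exists n : int, z = 2 * pi * n%:~R.
  move=> hv; have [|c] := @IVT _ d a b z ab _ hv.
    apply: continuous_in_subspaceT => t; rewrite inE /= in_itv /=; exact: cd.
  by rewrite in_itv /= => cab <-; apply: cos_eq1; exact: d1.
apply/eqP/negPn/negP => dab.
pose m := Num.min (d a) (d b); pose M := Num.max (d a) (d b).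
have mM : m < M by rewrite /m /M; case: (ltgtP (d a) (d b)) dab.
have [n nE] : exists n : int, m = 2 * pi * n%:~R.
  by apply: ivt; rewrite -/m -/M lexx ltW.
(* Both [m] and [m + e] are values of [d], yet they differ by a positive amount of at most pi, less
   than 2 pi. *)
pose e := Num.min (M - m) pi.
have [e1 e2 e3] : [/\ 0 < e, e <= M - m & e <= pi].
  rewrite /e; split; [by rewrite lt_min p0 andbT; lra|by rewrite ge_min lexx|].
  by rewrite ge_min lexx orbT.
have [k kE] : exists n : int, m + e = 2 * pi * n%:~R.
  by apply: ivt; rewrite -/m -/M; lra.
have : 2 * pi * (k - n)%:~R = e by rewrite intrB; lra.
have [kn|kn] := leP (k - n) 0.
  have : (k - n)%:~R <= (0 : R) by rewrite -[0]/(0%:~R) ler_int.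
  by rewrite -(pmulr_rle0 _ p0); lra.
have : (1 : R) <= (k - n)%:~R by rewrite -[1]/(1%:~R) ler_int.
by rewrite -(ler_pMr _ p0); lra.
Qed.

Lemma turnvv v : turn v v = 0.
Proof. by rewrite /turn /det2 (mulrC v.2) subrr mul0r atan0. Qed.

Lemma turn_bound v w : - (pi / 2) < turn v w < pi / 2.
Proof. by rewrite atan_gtNpi2 atan_ltpi2. Qed.

Lemma dot2_gt0 v : v != 0 -> 0 < dot2 v v.
Proof.
case: v => a b; rewrite /dot2 /= => v0.
rewrite lt0r addr_ge0 ?sqr_ge0 -?expr2 // ?sqr_ge0 // andbT.
apply: contra v0; rewrite paddr_eq0 ?sqr_ge0 // !sqrf_eq0 => /andP[/eqP-> /eqP->].
by [].
Qed.
End ArgumentTheory.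

(** * Open conditions and their uniformity on a segment *)

Section Perturbation.
Variable R : realType.
Implicit Types v w : R * R.

Lemma gt0_pert (F : (R * R) * (R * R) -> R) v w :
  {for (v, w), continuous F} -> 0 < F (v, w) ->
  exists e : R, 0 < e /\ forall v' w', `|v' - v| < e -> `|w' - w| < e -> 0 < F (v', w').
Proof.
move=> cF F0.
have /nbhs_ballP[e /= e0 H] : \forall z \near (v, w), 0 < F z.
  exact: cvgr_gt cF _ F0.
exists e; split => // v' w' hv hw; apply: H; split; rewrite /= -ball_normE /=.
  by rewrite distrC.
by rewrite distrC.
Qed.

Lemma dot2_pert v w : 0 < dot2 v w ->
  exists e : R, 0 < e /\
    forall v' w', `|v' - v| < e -> `|w' - w| < e -> 0 < dot2 v' w'.
Proof.
move=> vw; apply: (@gt0_pert (fun z => dot2 z.1 z.2)) => //.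
by apply: continuous_dot; [exact: (@cvg_fst _ _ (nbhs v) (nbhs w))|
  exact: (@cvg_snd _ _ (nbhs v) (nbhs w))].
Qed.

Lemma det2_pert v w : 0 < det2 v w ->
  exists e : R, 0 < e /\
    forall v' w', `|v' - v| < e -> `|w' - w| < e -> 0 < det2 v' w'.
Proof.
move=> vw; apply: (@gt0_pert (fun z => det2 z.1 z.2)) => //.
by apply: continuous_det; [exact: (@cvg_fst _ _ (nbhs v) (nbhs w))|
  exact: (@cvg_snd _ _ (nbhs v) (nbhs w))].
Qed.

(** Compactness of the segment as near covering along the filter [0^'+]; the scale [e] is an
    argument of [Q] because it is the variable of that filter. *)
Lemma segment_uniform (a b : R) (Q : R -> R -> Prop) :
  (forall t, a <= t <= b -> exists d : R, 0 < d /\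
     forall t', `|t' - t| < d -> forall e, 0 < e < d -> Q e t') ->
  exists d : R, 0 < d /\ forall e, 0 < e < d -> forall t, a <= t <= b -> Q e t.
Proof.
move=> H.
have /compact_near_coveringP/(_ R (0^'+) Q _) := @segment_compact R a b.
case.
  move=> t; rewrite /= in_itv /= => /H [d [d0 Hd]].
  exists (ball t d, [set e | 0 < e < d]) => /=.
    split; first exact: nbhsx_ballx.
    exists d => //= e; rewrite /= sub0r normrN => + e0.
    by rewrite gtr0_norm // e0.
  by move=> [t' e] [/=]; rewrite -ball_normE /= distrC => tt' ed; exact: Hd.
move=> d /= d0 Hd; exists d; split => // e /andP[e0 ed] t tab.
apply: (Hd e) => //=.
by rewrite sub0r normrN gtr0_norm.
Qed.
End Perturbation.

(** * Continuous arguments along a loop *)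

Section Winding.
Variable R : realType.
Implicit Types (v w : R * R) (t : R) (f h : R -> R * R) (th : R -> R).

Definition arg_lift f th : Prop := continuous th /\ forall t, has_arg (f t) (th t).

Definition loop f : Prop :=
  [/\ continuous f, forall t, f (t + 1) = f t & forall t, f t != 0].

(** A total function: the value 0 is a mere default, and [lift_ex] with [loop_wn] shows that it does
    not occur as such for a loop. *)
Definition wn f : int :=
  xget 0 [set n | exists th, arg_lift f th /\ th 1 - th 0 = 2 * pi * n%:~R].

Lemma lift_turn f h th : continuous f -> continuous h ->
  (forall t, 0 < dot2 (f t) (h t)) -> arg_lift f th ->
  arg_lift h (fun t => th t + turn (f t) (h t)).
Proof.
move=> cf ch fh [cth ath]; split => t; last exact: (has_arg_turn (fh t) (ath t)).
by apply: cvgD; [exact: cth|exact: (continuous_turn (cf t) (ch t) (fh t))].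
Qed.

Lemma lift_eq f th th' a b : arg_lift f th -> arg_lift f th' ->
  th b - th a = th' b - th' a.
Proof.
move=> [c h] [c' h'].
wlog ab : a b / a <= b.
  move=> H; have [/H//|/ltW/H] := leP a b; lra.
have := @cos_eq1_const R a b (fun t => th t - th' t) ab.
suff /[swap] /[apply] : forall t, a <= t <= b -> cos (th t - th' t) = 1.
  suff /[swap] /[apply] : forall t, a <= t <= b ->
    {for t, continuous (fun t => th t - th' t)} by lra.
  by move=> t _; apply: cvgB; [exact: c|exact: c'].
by move=> t _; exact: has_arg_cosB.
Qed.

Lemma periodicz (T : Type) (f : R -> T) t (n : int) :
  (forall t, f (t + 1) = f t) -> f (t + n%:~R) = f t.
Proof.
move=> fp.
have H s (k : nat) : f (s + k%:R) = f s.
  by elim: k s => [|k IH] s; rewrite ?addr0 // -natr1 addrA fp.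
case: n => n; first exact: H.
by rewrite -(H _ n.+1) NegzE mulrNz -pmulrn subrK.
Qed.

Lemma lift_period f th t : (forall t, f (t + 1) = f t) -> arg_lift f th ->
  th (t + 1) - th t = th 1 - th 0.
Proof.
move=> fp [c h].
have l1 : arg_lift f (fun s => th (s + 1)).
  split=> s; last by rewrite -fp.
  by apply: continuous_comp; [apply: cvgD; [exact: cvg_id|exact: cvg_cst]|exact: c].
have := lift_eq 0 t l1 (conj c h); rewrite add0r; lra.
Qed.

Lemma loop_near f : loop f -> exists d : R, 0 < d /\
  forall s t, `|s - t| < d -> 0 < dot2 (f s) (f t).
Proof.
move=> [cf fp f0].
have [|d [d0 Hd]] := @segment_uniform R 0 1
  (fun e t => forall s, `|s - t| < e -> 0 < dot2 (f s) (f t)).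
  move=> t _; have [e [e0 He]] := dot2_pert (dot2_gt0 (f0 t)).
  have := cf t; move/cvgr_distC_lt/(_ e e0) => /nbhs_ballP[d /= d0 Hd].
  exists (d / 2); split; first lra.
  move=> t' tt' e' e'd s st'; apply: He; apply: Hd; rewrite -ball_normE /= distrC.
    by rewrite -(subrK t' s) -addrA (le_lt_trans (ler_normD _ _)) //; lra.
  by lra.
exists (d / 2); split; first lra.
(* Periodicity carries the uniform bound from [0, 1] to the whole line: both parameters are shifted
   by the integer part of [t]. *)
move=> s t st; pose n := Num.floor t.
have E x : f x = f (x - n%:~R) by rewrite -[RHS](periodicz _ n fp) subrK.
rewrite (E s) (E t); apply: (Hd (d / 2)); first lra.
  by have := Num.Theory.floor_itv t; rewrite -/n intrD; lra.
by rewrite opprB addrA subrK.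
Qed.

(** The loop is unrolled from the constant [f 0]: [cl k] clamps the parameter to [- k h, k h]. Two
    successive clampings differ by at most h = d / 2, so [turn] transports an argument from one to
    the next. The lifts [th k] stabilise on bounded sets and are glued. *)
Lemma lift_ex f : loop f -> exists th, arg_lift f th.
Proof.
move=> lf; have [cf fp f0] := lf; have [d [d0 Hd]] := loop_near lf.
have [h [h0 dE]] : exists h : R, 0 < h /\ d = h * 2 by exists (d / 2); lra.
pose cl (k : nat) (t : R) := Num.max (- (k%:R * h)) (Num.min t (k%:R * h)).
have clE k t : `|t| <= k%:R * h -> cl k t = t.
  by rewrite ler_norml => /andP[t1 t2]; rewrite /cl min_l // max_r.
have clS k t : `|cl k t - cl k.+1 t| < d.
  have kh : 0 <= k%:R * h by rewrite mulr_ge0 // ltW.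
  rewrite /cl -natr1 mulrDl mul1r.
  set x := k%:R * h in kh *.
  rewrite ltr_norml dE.
  have [? ?] : - x <= x /\ - (x + h) <= x + h by lra.
  case: (leP t x) => ?; case: (leP t (x + h)) => ?.
  - by case: (leP (- x) t) => ?; case: (leP (- (x + h)) t) => ?; lra.
  - by lra.
  - by rewrite (max_r (_ : - x <= x)) // (max_r (_ : - (x + h) <= t)); lra.
  - by rewrite !max_r //; lra.
have ccl k : continuous (cl k).
  have cc (c : R) (t : R) : {for t, continuous (fun=> c : R^o)} by exact: cvg_cst.
  move=> t; exact: (continuous_max (cc (- (k%:R * h)) t)
    (continuous_min (@cvg_id _ (nbhs t)) (cc (k%:R * h) t))).
have cfcl k : continuous (f \o cl k).
  by move=> t; apply: continuous_comp; [exact: ccl|exact: cf].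
have [x0 hx0] := has_arg_ex (f0 0).
pose th := fix th k t := if k is k'.+1 then
  th k' t + turn (f (cl k' t)) (f (cl k t)) else x0.
have lth k : arg_lift (f \o cl k) (th k).
  elim: k => [|k IH].
    split; first by move=> t; exact: cvg_cst.
    move=> t /=; suff -> : cl 0 t = 0 by [].
    by rewrite /cl mul0r oppr0; case: (leP t 0) => // ?; exact: max_l.
  by apply: (lift_turn (cfcl k) (cfcl k.+1) _ IH) => t; exact: Hd.
have thS k t : `|t| <= k%:R * h -> th k.+1 t = th k t.
  move=> tk /=; rewrite (clE _ _ tk) clE ?turnvv ?addr0 //.
  by rewrite (le_trans tk) // ler_pM2r // ler_nat.
have thE k j t : `|t| <= k%:R * h -> (k <= j)%N -> th j t = th k t.
  move=> tk; elim: j => [|j IH]; first by rewrite leqn0 => /eqP ->.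
  rewrite leq_eqVlt => /orP[/eqP->//|kj]; rewrite thS ?IH //.
  by rewrite (le_trans tk) // ler_pM2r // ler_nat.
(* A level at which [t] lies strictly inside the clamping interval, so the glued lift equals the
   single function [th (K t)] on a neighbourhood of [t]. *)
pose K t := (Num.trunc (`|t| / h)).+1.
have KP t : `|t| < (K t)%:R * h.
  by rewrite -ltr_pdivrMr // /K Num.Theory.truncnS_gt.
have thK k t : `|t| <= k%:R * h -> th (K t) t = th k t.
  move=> tk; have [kK|Kk] := leqP k (K t); first exact: thE.
  by rewrite -(thE _ _ _ (ltW (KP t)) (ltnW Kk)).
exists (fun t => th (K t) t); split=> t; last first.
  by have := (lth (K t)).2 t; rewrite /= clE // ltW.
have c1 := (lth (K t)).1 t.
rewrite /continuous_at; apply: cvg_trans c1; apply: near_eq_cvg.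
have : \forall s \near t, `|s| < (K t)%:R * h.
  by have := @norm_continuous R R t; move/cvgr_lt; apply; exact: KP.
by apply: filterS => s sK; apply/esym; apply: thK; exact: ltW.
Qed.
End Winding.

Section WindingTheory.
Variable R : realType.
Implicit Types (v w d : R * R) (t x y : R) (f h : R -> R * R) (th : R -> R).

Lemma loop_wn f th : loop f -> arg_lift f th -> th 1 - th 0 = 2 * pi * (wn f)%:~R.
Proof.
move=> lf lth; have [cf fp f0] := lf.
have [n nE] : exists n : int, th 1 - th 0 = 2 * pi * n%:~R.
  by apply/cos_eq1/(has_arg_cosB (lth.2 1)); rewrite -(add0r 1) fp; exact: lth.2.
have [th' [lth' <-]] : exists th', arg_lift f th' /\ th' 1 - th' 0 = 2 * pi * (wn f)%:~R.
  apply: (@xgetPex _ 0 [set n : int | exists th', arg_lift f th' /\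
    th' 1 - th' 0 = 2 * pi * n%:~R]).
  by exists n, th.
exact: (lift_eq 0 1 lth lth').
Qed.

Lemma intr2pi_inj (m n : int) : 2 * pi * m%:~R = 2 * pi * n%:~R :> R -> m = n.
Proof.
by have p0 := pi_gt0 R; move=> /mulfI H; apply/(@intr_inj R)/H; rewrite gt_eqF; lra.
Qed.

(** The correction [turn (f t) (h t)] between the two lifts is itself 1-periodic, hence contributes
    nothing over a period. *)
Lemma wn_dot f h : loop f -> loop h -> (forall t, 0 < dot2 (f t) (h t)) ->
  wn f = wn h.
Proof.
move=> lf lh fh; have [th lth] := lift_ex lf; have [cf fp _] := lf.
have [ch hp _] := lh; have lth' := lift_turn cf ch fh lth.
apply: intr2pi_inj; rewrite -(loop_wn lf lth) -(loop_wn lh lth').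
have -> : f 1 = f 0 by rewrite -(add0r 1) fp.
have -> : h 1 = h 0 by rewrite -(add0r 1) hp.
by ring.
Qed.

Lemma loop_shift f b : loop f -> loop (fun t => f (b + t)).
Proof.
move=> [cf fp f0]; split => [t|t|t]; last exact: f0; last by rewrite addrA fp.
by apply: continuous_comp; [apply: cvgD; [exact: cvg_cst|exact: cvg_id]|exact: cf].
Qed.

Lemma wn_shift f b : loop f -> wn (fun t => f (b + t)) = wn f.
Proof.
move=> lf; have [th [cth ath]] := lift_ex lf; have [cf fp _] := lf.
apply: intr2pi_inj; rewrite -(loop_wn lf (conj cth ath)).
have l1 : arg_lift (fun t => f (b + t)) (fun t => th (b + t)).
  split=> t; last exact: ath.
  by apply: continuous_comp; [apply: cvgD; [exact: cvg_cst|exact: cvg_id]|exact: cth].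
rewrite -(loop_wn (loop_shift b lf) l1) addr0.
exact: lift_period.
Qed.

Lemma is_winding_numberP c (x : R * R) (n : int) : loop (fun t => c t - x) ->
  is_winding_number c x n <-> n = wn (fun t => c t - x).
Proof.
move=> lc; split=> [[th [cth ath nE]]|->].
  by apply: intr2pi_inj; rewrite -nE; apply: loop_wn.
have [th [cth ath]] := lift_ex lc.
by exists th; split => //; exact: loop_wn.
Qed.

Lemma has_arg_dot d v x y : has_arg d x -> has_arg v y ->
  exists k : R, [/\ 0 < k, dot2 d v = k * cos (y - x) & det2 d v = k * sin (y - x)].
Proof.
move=> [r [r0 ->]] [s [s0 ->]]; exists (r * s); split; first exact: mulr_gt0.
  by rewrite /dot2 cosB /=; ring.
by rewrite /det2 sinB /=; ring.
Qed.

Lemma pi_window x : exists k : int, - (pi / 2) <= x - 2 * pi * k%:~R < 3 * pi / 2.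
Proof.
have p0 := pi_gt0 R; pose n := Num.floor ((x + pi / 2) / (2 * pi)); exists n.
have /andP[] := Num.Theory.floor_itv ((x + pi / 2) / (2 * pi)); rewrite -/n.
rewrite ler_pdivlMr ?ltr_pdivrMr; [|lra|lra]; rewrite intrD => n1 n2.
lra.
Qed.

Lemma cosBz x (n : int) : cos (x - 2 * pi * n%:~R) = cos x.
Proof. by rewrite -[RHS](cosD2piz _ (- n)) mulrNz mulrN. Qed.

Lemma cos_le0 x : pi / 2 <= x <= 3 * pi / 2 -> cos x <= 0.
Proof.
move=> hx; have -> : x = x - pi + pi by ring.
by rewrite cosDpi oppr_le0 cos_ge0_pihalf //; lra.
Qed.

Lemma cos_gt0_window x : 0 < cos x ->
  exists k : int, - (pi / 2) < x - 2 * pi * k%:~R < pi / 2.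
Proof.
have p0 := pi_gt0 R.
move=> cx; have [k /andP[k1 k2]] := pi_window x; exists k.
have cy := cosBz x k; set y := x - _ in k1 k2 cy *.
apply/andP; split; rewrite ltNge; apply/negP => yp.
  have : cos y = 0 by rewrite (_ : y = - (pi / 2)) ?cosN ?cos_pihalf //; lra.
  lra.
have : cos y <= 0 by apply: cos_le0; lra.
lra.
Qed.

(* The third hypothesis says that the argument A avoids the upward ray. *)
Lemma slit_window (A : R -> R) (a b : R) : a <= b -> continuous A ->
  (forall t, a <= t <= b -> cos (A t) = 0 -> sin (A t) < 0) ->
  cos (A a) < 0 -> 0 < cos (A b) ->
  exists k : int, - (3 * pi / 2) < A a - 2 * pi * k%:~R < - (pi / 2) /\
                  - (pi / 2) < A b - 2 * pi * k%:~R < pi / 2.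
Proof.
have p0 := pi_gt0 R.
move=> ab cA hA ca /cos_gt0_window[k /andP[k1 k2]].
exists k; split; last by rewrite k1.
set z := A a - _.
have ivt u : Num.min (A a) (A b) <= u <= Num.max (A a) (A b) ->
    cos u = 0 -> sin u < 0.
  move=> hu; have [|c] := @IVT _ A a b u ab _ hu.
    by apply: continuous_in_subspaceT => t _; exact: cA.
  by rewrite in_itv /= => cab <-; exact: hA.
have cz : cos z < 0 by rewrite cosBz.
have z1 : z < pi / 2.
  rewrite ltNge; apply/negP => zp.
  (* If [z] were beyond pi / 2, then [A] would pass through an argument of the upward ray, where the
     sine is 1 instead of negative. *)
  have := ivt (pi / 2 + 2 * pi * k%:~R).
  rewrite cosD2piz cos_pihalf -cosBpihalf addrAC subrr add0r -[2 * _ * _]add0r.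
  rewrite cosD2piz cos0 add0r => H.
  suff : (1 : R) < 0 by lra.
  apply: H => //; rewrite ge_min le_max; apply/andP; split; apply/orP.
    by right; lra.
  by left; rewrite /z in zp; lra.
have z2 : - (3 * pi / 2) < z.
  rewrite ltNge; apply/negP => zp.
  have := ivt (pi / 2 + 2 * pi * (k - 1)%:~R).
  rewrite cosD2piz cos_pihalf -cosBpihalf addrAC subrr add0r -[2 * _ * _]add0r.
  rewrite cosD2piz cos0 add0r intrB => H.
  suff : (1 : R) < 0 by lra.
  apply: H => //; rewrite ge_min le_max; apply/andP; split; apply/orP.
    by left; rewrite /z in zp; lra.
  by right; lra.
rewrite z2 ltNge; apply/negP => zp.
have : 0 <= cos z by apply: cos_ge0_pihalf; lra.
lra.
Qed.

(** Distinct multiples of 2 pi are more than 3 pi / 2 apart. This bound is the sum of three angles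
    each known up to pi / 2, as needed in [wn_crossing]. *)
Lemma cos_eq1_near x (m : int) : cos x = 1 ->
  - (3 * pi / 2) < x - 2 * pi * m%:~R < 3 * pi / 2 -> x = 2 * pi * m%:~R.
Proof.
have p0 := pi_gt0 R.
move=> /cos_eq1[n ->] /andP[]; rewrite -mulrBr -intrB => h1 h2.
suff : n - m = 0 by move/subr0_eq ->.
apply/eqP; rewrite eq_le; apply/andP; split; rewrite leNgt; apply/negP.
  rewrite -[_ < _]/(1 <= n - m) -(ler_int R) => h3.
  have : pi * 1 <= pi * (n - m)%:~R :> R by rewrite ler_pM2l.
  by rewrite /=; lra.
rewrite -[_ < 0]/(_ <= - 1 :> int) -(ler_int R) => h3.
have : pi * (n - m)%:~R <= pi * (- 1)%:~R :> R by rewrite ler_pM2l.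
rewrite mulrNz; lra.
Qed.

(* The origin crosses the branch of the curve over [s - w, s + w], which runs
   in the direction d: it is on the left of f and on the right of h. *)
Lemma wn_crossing f h d (s w : R) : loop f -> loop h -> 0 < w < 1 / 2 ->
  (forall t, s + w <= t <= s + 1 - w -> 0 < dot2 (h t) (f t)) ->
  (forall t, s - w <= t <= s + w -> dot2 d (f t) = 0 -> det2 d (f t) < 0) ->
  (forall t, s - w <= t <= s + w -> dot2 d (h t) = 0 -> 0 < det2 d (h t)) ->
  dot2 d (f (s - w)) < 0 < dot2 d (f (s + w)) ->
  dot2 d (h (s - w)) < 0 < dot2 d (h (s + w)) ->
  wn f = wn h + 1.
Proof.
have p0 := pi_gt0 R.
move=> lf lh w0 hf ff fh /andP[fa fb] /andP[ha hb].
have [cf fp _] := lf; have [ch hp _] := lh.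
have [th lth] := lift_ex lf; have [th' lth'] := lift_ex lh.
have d0 : d != 0.
  by apply: contraTneq fb => ->; rewrite /dot2 !mul0r addr0 ltxx.
have [p hpd] := has_arg_ex d0.
(* Arguments relative to the direction [d]. The sign of [B] is reversed because [h] passes on the
   other side: both functions then avoid the same ray and [slit_window] applies to each. *)
pose A t := th t - p; pose B t := p - th' t.
have cA : continuous A by move=> t; apply: cvgB; [exact: lth.1|exact: cvg_cst].
have cB : continuous B by move=> t; apply: cvgB; [exact: cvg_cst|exact: lth'.1].
have fA t := has_arg_dot hpd (lth.2 t).
have hB t : exists k : R, [/\ 0 < k, dot2 d (h t) = k * cos (B t)
    & det2 d (h t) = - (k * sin (B t))].
  have [k [k0 -> ->]] := has_arg_dot hpd (lth'.2 t); exists k; split => //.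
    by rewrite /B -opprB cosN.
  by rewrite /B -opprB sinN mulrN.
have ab : s - w <= s + w by lra.
have [|||k [ka kb]] := slit_window ab cA.
- move=> t tab cA0; have [l [l0 E1 E2]] := fA t.
  have := ff t tab; rewrite E1 E2 -/(A t) cA0 mulr0 => /(_ erefl).
  by rewrite pmulr_rlt0.
- by have [l [l0 E1 _]] := fA (s - w); move: fa; rewrite E1 pmulr_rlt0.
- by have [l [l0 E1 _]] := fA (s + w); move: fb; rewrite E1 pmulr_rgt0.
have [|||k' [k'a k'b]] := slit_window ab cB.
- move=> t tab cB0; have [l [l0 E1 E2]] := hB t.
  have := fh t tab; rewrite E1 E2 cB0 mulr0 => /(_ erefl).
  by rewrite oppr_gt0 pmulr_rlt0.
- by have [l [l0 E1 _]] := hB (s - w); move: ha; rewrite E1 pmulr_rlt0.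
- by have [l [l0 E1 _]] := hB (s + w); move: hb; rewrite E1 pmulr_rgt0.
(* A multiple of 2 pi wherever [f] and [h] have positive dot product, so it is constant on the long
   arc [s + w, s + 1 - w]. The difference of the winding numbers is therefore produced on the short
   arc alone. *)
pose E t := th t - (th' t + turn (h t) (f t)).
have E1 t : 0 < dot2 (h t) (f t) -> cos (E t) = 1.
  by move=> hft; apply: (has_arg_cosB (lth.2 t)); apply: has_arg_turn (lth'.2 t).
have shift : s - w + 1 = s + 1 - w by ring.
have fw : f (s + 1 - w) = f (s - w) by rewrite -shift fp.
have hw : h (s + 1 - w) = h (s - w) by rewrite -shift hp.
(* At this end [A] and [B] both lie within pi / 2 of -pi (modulo their windows), at the other end
   within pi / 2 of 0: hence the -1 here and not in [Eb]. *)
have Ea : E (s - w) = 2 * pi * (k + k' - 1)%:~R.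
  apply: cos_eq1_near.
    by apply: E1; rewrite -fw -hw; apply: hf; lra.
  have := turn_bound (h (s - w)) (f (s - w)).
  by rewrite /E intrB intrD; move: ka k'a; rewrite /A /B; lra.
have Eb : E (s + w) = 2 * pi * (k + k')%:~R.
  apply: cos_eq1_near; first by apply: E1; apply: hf; lra.
  have := turn_bound (h (s + w)) (f (s + w)).
  by rewrite /E intrD; move: kb k'b; rewrite /A /B; lra.
have Ec : E (s + w) = E (s + 1 - w).
  apply: cos_eq1_const => [|t tI|t tI]; [lra| |exact/E1/hf].
  apply: cvgB; first exact: lth.1.
  by apply: cvgD; [exact: lth'.1|exact: continuous_turn (ch t) (cf t) (hf t tI)].
apply: intr2pi_inj; have := loop_wn lf lth; have := loop_wn lh lth'.
have := lift_period (s - w) fp lth; have := lift_period (s - w) hp lth'.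
rewrite shift; move: Ea Eb Ec; rewrite /E fw hw !intrB !intrD; lra.
Qed.
End WindingTheory.

(** * Families of curves and their double points *)

Section Families.
Variable R : realType.
Implicit Types (a da : R -> R -> R * R) (u s t : R) (v w : R * R).

Lemma pair_norm_lt v (e : R) : (`|v| < e) = (`|v.1| < e) && (`|v.2| < e).
Proof. by rewrite prod_normE gt_max. Qed.

Definition jointly_continuous (f : R -> R -> R * R) : Prop :=
  forall u t e, 0 < e -> exists d : R, 0 < d /\
    forall u' t', `|u' - u| < d -> `|t' - t| < d -> `|f u' t' - f u t| < e.

(* The parameter 0 stands for the endpoint of the bridge, which is not a double
   point; hence visits are ordered by their parameters in [0, 1[. *)
Record curve_family a da : Prop := CurveFamily {
  fam_cont : jointly_continuous a;
  fam_dcont : jointly_continuous da;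
  fam_der1 : forall u t, is_derive t 1 (fun s => (a u s).1) (da u t).1;
  fam_der2 : forall u t, is_derive t 1 (fun s => (a u s).2) (da u t).2;
  fam_per : forall u t, a u (t + 1) = a u t;
  fam_imm : forall u t, da u t != 0;
  fam_trans : forall u s t, 0 < s -> s < t -> t < 1 -> a u s = a u t ->
    det2 (da u s) (da u t) != 0;
  fam_base : forall u t, 0 < t < 1 -> a u t != a u 0 }.

Lemma ball_between (x y c t d : R) : Num.min x y <= c <= Num.max x y ->
  `|x - t| < d -> `|y - t| < d -> `|c - t| < d.
Proof.
by rewrite !ltr_norml; case: (leP x y) => ? /andP[? ?] /andP[? ?] /andP[? ?]; lra.
Qed.

Lemma mvt_between (f df : R -> R) x y :
  (forall t, is_derive t 1 f (df t)) ->
  exists c, Num.min x y <= c <= Num.max x y /\ f x - f y = (x - y) * df c.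
Proof.
move=> fdf.
have cf (p q : R) : {within `[p, q], continuous f}.
  by apply: derivable_within_continuous => t _; have := fdf t => ?; exact: ex_derive.
have [yx|/ltW xy] := leP y x.
  have [c] := MVT_segment yx (fun t _ => fdf t) (cf _ _).
  by rewrite in_itv /= => cI E; exists c; split=> //; rewrite E mulrC.
have [c] := MVT_segment xy (fun t _ => fdf t) (cf _ _).
by rewrite in_itv /= => cI E; exists c; split=> //; rewrite -opprB E; ring.
Qed.

Section Local.
Variables (a da : R -> R -> R * R) (fam : curve_family a da).

(** The mean value theorem is applied to each coordinate with its own intermediate point; joint
    continuity of [da] makes the resulting vector close to [da u0 t] uniformly in the time. This
    replaces differentiability in [u]. *)
Lemma fam_chord u0 t e : 0 < e -> exists d : R, 0 < d /\
  forall u s s', `|u - u0| < d -> `|s - t| < d -> `|s' - t| < d ->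
    exists D, `|D - da u0 t| < e /\ a u s - a u s' = (s - s') *: D.
Proof.
move=> e0; have [d [d0 Hd]] := fam_dcont fam u0 t e0.
exists d; split=> // u s s' uu st s't.
have [c1 [c1I E1]] := mvt_between s s' (fam_der1 fam u).
have [c2 [c2I E2]] := mvt_between s s' (fam_der2 fam u).
exists ((da u c1).1, (da u c2).2); split; last first.
  by rewrite [LHS]surjective_pairing /= E1 E2.
have := Hd u c1 uu (ball_between c1I st s't).
have := Hd u c2 uu (ball_between c2I st s't).
by rewrite !pair_norm_lt /= => /andP[_ ->] /andP[-> _].
Qed.

Lemma fam_diff_cont u0 t1 t2 e : 0 < e -> exists d : R, 0 < d /\
  forall u s1 s2, `|u - u0| < d -> `|s1 - t1| < d -> `|s2 - t2| < d ->
    `|(a u s1 - a u s2) - (a u0 t1 - a u0 t2)| < e.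
Proof.
move=> e0; have e2 : 0 < e / 2 by lra.
have [d1 [d10 H1]] := fam_cont fam u0 t1 e2.
have [d2 [d20 H2]] := fam_cont fam u0 t2 e2.
exists (Num.min d1 d2); split; first by rewrite lt_min d10.
move=> u s1 s2; rewrite !lt_min => /andP[u1 u2] /andP[s11 _] /andP[_ s22].
have -> : a u s1 - a u s2 - (a u0 t1 - a u0 t2) =
    (a u s1 - a u0 t1) - (a u s2 - a u0 t2).
  by rewrite !opprB addrACA [RHS]addrACA; congr (_ + _); rewrite addrC.
by rewrite (le_lt_trans (ler_normB _ _)) //; have := H1 _ _ u1 s11;
  have := H2 _ _ u2 s22; lra.
Qed.

Lemma det2_sgz_pert v w : det2 v w != 0 -> exists e : R, 0 < e /\
  forall v' w', `|v' - v| < e -> `|w' - w| < e ->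
    sgz (det2 v' w') = sgz (det2 v w).
Proof.
have detC x y : det2 x y = - det2 y x :> R by rewrite /det2; ring.
rewrite neq_lt => /orP[vw|vw]; last first.
  have [e [e0 He]] := det2_pert vw; exists e; split => // v' w' hv hw.
  by rewrite !gtr0_sgz // He.
have [|e [e0 He]] := @det2_pert _ w v; first by rewrite detC oppr_gt0.
exists e; split => // v' w' hv hw.
by rewrite !ltr0_sgz // detC oppr_lt0 He.
Qed.

Lemma fam_det_sgz u0 t1 t2 : det2 (da u0 t1) (da u0 t2) != 0 ->
  exists d : R, 0 < d /\
  forall u s1 s2, `|u - u0| < d -> `|s1 - t1| < d -> `|s2 - t2| < d ->
    sgz (det2 (da u s1) (da u s2)) = sgz (det2 (da u0 t1) (da u0 t2)).
Proof.
move=> /det2_sgz_pert[e [e0 He]].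
have [d1 [d10 H1]] := fam_dcont fam u0 t1 e0.
have [d2 [d20 H2]] := fam_dcont fam u0 t2 e0.
exists (Num.min d1 d2); split; first by rewrite lt_min d10.
move=> u s1 s2; rewrite !lt_min => /andP[u1 u2] /andP[s11 _] /andP[_ s22].
by apply: He; [exact: H1|exact: H2].
Qed.

Lemma det2Zl k v w : det2 (k *: v) w = k * det2 v w :> R.
Proof. by rewrite /det2 /= /GRing.scale /=; ring. Qed.

Lemma det2Zr k v w : det2 v (k *: w) = k * det2 v w :> R.
Proof. by rewrite /det2 /= /GRing.scale /=; ring. Qed.

Lemma det2vv v : det2 v v = 0 :> R.
Proof. by rewrite /det2; ring. Qed.

(** Two crossings of the same branches would give proportional chords, one along each branch, while
    chords stay close to independent tangents. *)
Lemma crossing_uniq u0 t1 t2 : det2 (da u0 t1) (da u0 t2) != 0 ->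
  exists r : R, 0 < r /\ forall u, `|u - u0| < r -> forall s1 s2 s1' s2',
    `|s1 - t1| < r -> `|s2 - t2| < r -> `|s1' - t1| < r -> `|s2' - t2| < r ->
    a u s1 = a u s2 -> a u s1' = a u s2' -> s1 = s1' /\ s2 = s2'.
Proof.
move=> dt; have [e [e0 He]] := det2_sgz_pert dt.
have [d1 [d10 H1]] := fam_chord u0 t1 e0.
have [d2 [d20 H2]] := fam_chord u0 t2 e0.
exists (Num.min d1 d2); split; first by rewrite lt_min d10.
move=> u; rewrite !lt_min => /andP[u1 u2] s1 s2 s1' s2'.
rewrite !lt_min => /andP[s11 _] /andP[_ s22] /andP[s11' _] /andP[_ s22'] E E'.
have [D1 [D1e E1]] := H1 _ _ _ u1 s11 s11'.
have [D2 [D2e E2]] := H2 _ _ _ u2 s22 s22'.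
have D0 : det2 D1 D2 != 0.
  by rewrite -sgz_eq0 (He _ _ D1e D2e) sgz_eq0.
have EE : (s1 - s1') *: D1 = (s2 - s2') *: D2 by rewrite -E1 -E2 E E'.
split; apply/eqP; rewrite -subr_eq0.
  have := congr1 (fun z => det2 z D2) EE.
  by rewrite !det2Zl det2vv mulr0 => /eqP; rewrite mulf_eq0 (negPf D0) orbF.
have := congr1 (fun z => det2 D1 z) EE.
by rewrite !det2Zr det2vv mulr0 => /esym/eqP; rewrite mulf_eq0 (negPf D0) orbF.
Qed.

Lemma fam_continuous u : continuous (a u).
Proof.
move=> t; apply/cvgrPdist_lt => e e0; have [d [d0 Hd]] := fam_cont fam u t e0.
apply/nbhs_ballP; exists d => //= t' tt'.
by rewrite distrC Hd ?subrr ?normr0 // distrC.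
Qed.

(** Squared Euclidean distance between two points of the curve, differentiable in the parameters and
    merely continuous in the time. *)
Let gap u s1 s2 : R := dot2 (a u s1 - a u s2) (a u s1 - a u s2).

Lemma gap_pos_near u0 t1 t2 s1 s2 : a u0 t1 = a u0 t2 -> a u0 s1 != a u0 s2 ->
  exists d : R, 0 < d /\ forall u s1' s2',
    `|u - u0| < d -> `|s1' - s1| < d -> `|s2' - s2| < d ->
    gap u t1 t2 < gap u s1' s2'.
Proof.
move=> Et Es; pose F (z : (R * R) * (R * R)) := dot2 z.1 z.1 - dot2 z.2 z.2.
pose v := a u0 s1 - a u0 s2.
have v0 : v != 0 by rewrite subr_eq0.
have [||e [e0 He]] := @gt0_pert _ F v 0.
- have c1 : {for (v, 0 : R * R), continuous fst}.
    exact: (@cvg_fst _ _ (nbhs v) (nbhs (0 : R * R))).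
  have c2 : {for (v, 0 : R * R), continuous snd}.
    exact: (@cvg_snd _ _ (nbhs v) (nbhs (0 : R * R))).
  by apply: cvgB; [exact: (continuous_dot c1 c1)|exact: (continuous_dot c2 c2)].
- by rewrite /F /= [dot2 0 0]/dot2 /= !mulr0 addr0 subr0; exact: dot2_gt0.
have [d1 [d10 H1]] := fam_diff_cont u0 s1 s2 e0.
have [d2 [d20 H2]] := fam_diff_cont u0 t1 t2 e0.
exists (Num.min d1 d2); split; first by rewrite lt_min d10.
move=> u s1' s2'; rewrite !lt_min => /andP[u1 u2] /andP[s11 _] /andP[s22 _].
have := He _ (a u t1 - a u t2) (H1 _ _ _ u1 s11 s22).
rewrite /F subr0 subr_gt0; apply.
have := H2 u t1 t2 u2; rewrite !subrr !normr0 => /(_ d20 d20).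
by rewrite Et subrr subr0.
Qed.

Lemma gap_critical u s1 s2 : is_derive s1 1 (fun x => gap u x s2) 0 ->
  dot2 (a u s1 - a u s2) (da u s1) = 0.
Proof.
move=> H.
have := fam_der1 fam u s1; have := fam_der2 fam u s1.
move=> D2 D1.
have E1 : is_derive s1 1 (fun x => (a u x).1 - (a u s2).1) (da u s1).1.
  by rewrite -[X in is_derive _ _ _ X]subr0; apply: is_deriveB.
have E2 : is_derive s1 1 (fun x => (a u x).2 - (a u s2).2) (da u s1).2.
  by rewrite -[X in is_derive _ _ _ X]subr0; apply: is_deriveB.
have E := is_deriveD (is_deriveM E1 E1) (is_deriveM E2 E2).
have := @derive_val _ _ _ _ _ _ _ E; have := @derive_val _ _ _ _ _ _ _ H.
rewrite /gap /dot2 /= => -> /=.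
rewrite /GRing.scale /=; lra.
Qed.

Lemma gapC u s1 s2 : gap u s1 s2 = gap u s2 s1.
Proof. by rewrite /gap /dot2 /=; ring. Qed.

(** Minimise [gap u] on a square around (t1, t2). By uniqueness the boundary carries no crossing at
    time [u0], so for [u] near [u0] the centre does better than the boundary and the minimum is
    interior. There the difference of the two points is orthogonal to both tangents, which are
    independent, so it vanishes. *)
Lemma crossing_exists u0 t1 t2 (r : R) : a u0 t1 = a u0 t2 ->
  det2 (da u0 t1) (da u0 t2) != 0 -> 0 < r -> exists d : R, 0 < d /\
  forall u, `|u - u0| < d -> exists s1 s2,
    [/\ `|s1 - t1| < r, `|s2 - t2| < r & a u s1 = a u s2].
Proof.
move=> Et dt r0.
have [r1 [r10 U]] := crossing_uniq dt.
have [r2 [r20 S]] := fam_det_sgz dt.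
pose m := Num.min r (Num.min r1 r2); pose p := m / 2.
have m0 : 0 < m by rewrite !lt_min r0 r10.
have [mr mr1 mr2] : [/\ m <= r, m <= r1 & m <= r2].
  by rewrite /m !ge_min !lexx !orbT.
have [p0 pm] : 0 < p /\ p < m by rewrite /p; lra.
have bd s1 s2 : `|s1 - t1| < m -> `|s2 - t2| < m -> s1 != t1 \/ s2 != t2 ->
    exists d : R, 0 < d /\ forall u s1' s2',
      `|u - u0| < d -> `|s1' - s1| < d -> `|s2' - s2| < d ->
      gap u t1 t2 < gap u s1' s2'.
  move=> h1 h2 ne; apply: gap_pos_near => //; apply/eqP => Es.
  have Z (x : R) : `|x - x| < r1 by rewrite subrr normr0.
  have [e1 e2] := U u0 (Z _) s1 s2 t1 t2 (lt_le_trans h1 mr1)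
    (lt_le_trans h2 mr1) (Z _) (Z _) Es Et.
  by move: ne; rewrite e1 e2 !eqxx => -[].
have side1 s1 : `|s1 - t1| = p -> exists d : R, 0 < d /\
    forall u, `|u - u0| < d -> forall s2, t2 - p <= s2 <= t2 + p ->
    gap u t1 t2 < gap u s1 s2.
  move=> hs1.
  have [|d [d0 Hd]] := @segment_uniform R (t2 - p) (t2 + p)
    (fun e s2 => forall u, `|u - u0| < e -> gap u t1 t2 < gap u s1 s2).
    move=> s2 hs2; have [||| d [d0 Hd]] := bd s1 s2.
    - by rewrite hs1.
    - by rewrite ltr_norml; lra.
    - by left; rewrite -subr_eq0 -normr_eq0 hs1 gt_eqF.
    exists d; split => // s2' hs2' e /andP[e0 ed] u hu.
    by apply: Hd; rewrite ?subrr ?normr0 //; lra.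
  exists (d / 2); split; first lra.
  by move=> u hu s2 hs2; apply: (Hd (d / 2)) => //; lra.
have side2 s2 : `|s2 - t2| = p -> exists d : R, 0 < d /\
    forall u, `|u - u0| < d -> forall s1, t1 - p <= s1 <= t1 + p ->
    gap u t1 t2 < gap u s1 s2.
  move=> hs2.
  have [|d [d0 Hd]] := @segment_uniform R (t1 - p) (t1 + p)
    (fun e s1 => forall u, `|u - u0| < e -> gap u t1 t2 < gap u s1 s2).
    move=> s1 hs1; have [||| d [d0 Hd]] := bd s1 s2.
    - by rewrite ltr_norml; lra.
    - by rewrite hs2.
    - by right; rewrite -subr_eq0 -normr_eq0 hs2 gt_eqF.
    exists d; split => // s1' hs1' e /andP[e0 ed] u hu.
    by apply: Hd; rewrite ?subrr ?normr0 //; lra.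
  exists (d / 2); split; first lra.
  by move=> u hu s1 hs1; apply: (Hd (d / 2)) => //; lra.
have pp : `|p| = p by rewrite gtr0_norm.
have [|d1 [d10 H1]] := side1 (t1 - p); first by rewrite addrAC subrr add0r normrN.
have [|d2 [d20 H2]] := side1 (t1 + p); first by rewrite addrAC subrr add0r.
have [|d3 [d30 H3]] := side2 (t2 - p); first by rewrite addrAC subrr add0r normrN.
have [|d4 [d40 H4]] := side2 (t2 + p); first by rewrite addrAC subrr add0r.
exists (Num.min (Num.min d1 d2) (Num.min (Num.min d3 d4) m)).
split; first by rewrite 4!lt_min d10 d20 d30 d40 m0.
move=> u; rewrite 4!lt_min => /andP[/andP[u1 u2] /andP[/andP[u3 u4] um]].
pose B : set (R * R) := `[t1 - p, t1 + p] `*` `[t2 - p, t2 + p].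
have [|||[s1 s2]] := @compact_EVT_min _ R (fun z : R * R => gap u z.1 z.2) B.
- by exists (t1, t2); split; rewrite /= in_itv /= gerBl lerDl ltW.
- by apply: compact_setX; exact: segment_compact.
- apply: continuous_in_subspaceT => -[x y] _.
  have c1 : {for (x, y), continuous (fun z : R * R => a u z.1)}.
    apply: continuous_comp; first exact: (@cvg_fst _ _ (nbhs x) (nbhs y)).
    exact: fam_continuous.
  have c2 : {for (x, y), continuous (fun z : R * R => a u z.2)}.
    apply: continuous_comp; first exact: (@cvg_snd _ _ (nbhs x) (nbhs y)).
    exact: fam_continuous.
  have c : {for (x, y), continuous (fun z : R * R => a u z.1 - a u z.2)}.
    by apply: cvgB.
  exact: (continuous_dot c c).
rewrite inE => -[/=]; rewrite !in_itv /= => h1 h2 Hmin.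
have Hm x y : t1 - p <= x <= t1 + p -> t2 - p <= y <= t2 + p ->
    gap u s1 s2 <= gap u x y.
  by move=> hx hy; apply: (Hmin (x, y)); rewrite inE; split; rewrite /= in_itv.
have Ht : gap u s1 s2 <= gap u t1 t2 by apply: Hm; rewrite gerBl lerDl ltW.
have n1 : t1 - p < s1 < t1 + p.
  rewrite !lt_neqAle !(andP h1).1 !(andP h1).2 !andbT; apply/andP; split.
    by apply/eqP => E; move: Ht; rewrite leNgt -E H1.
  by apply/eqP => E; move: Ht; rewrite leNgt E H2.
have n2 : t2 - p < s2 < t2 + p.
  rewrite !lt_neqAle !(andP h2).1 !(andP h2).2 !andbT; apply/andP; split.
    by apply/eqP => E; move: Ht; rewrite leNgt -E H3.
  by apply/eqP => E; move: Ht; rewrite leNgt E H4.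
have hr1 : `|s1 - t1| < m by apply: lt_trans pm; rewrite ltr_distl.
have hr2 : `|s2 - t2| < m by apply: lt_trans pm; rewrite ltr_distl.
exists s1, s2; split; [exact: lt_le_trans mr|exact: lt_le_trans mr|].
have dgap x y : derivable (fun z => gap u z y) x 1.
  have D1 := fam_der1 fam u x; have D2 := fam_der2 fam u x.
  by apply: derivableD; apply: derivableM; apply: derivableB => //; exact: ex_derive.
have K1 : is_derive s1 1 (fun x => gap u x s2) 0.
  apply: (@derive1_at_min _ _ (t1 - p) (t1 + p)); [lra| |by rewrite in_itv|].
    by move=> x _; exact: dgap.
  by move=> x; rewrite in_itv /= => hx; apply: Hm => //; lra.
have K2 : is_derive s2 1 (fun x => gap u x s1) 0.
  apply: (@derive1_at_min _ _ (t2 - p) (t2 + p)); [lra| |by rewrite in_itv|].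
    by move=> x _; exact: dgap.
  by move=> x; rewrite in_itv /= => hx; rewrite gapC [leRHS]gapC; apply: Hm => //; lra.
have := gap_critical K1; have := gap_critical K2.
have Sd := S u s1 s2 (lt_le_trans um mr2) (lt_le_trans hr1 mr2)
  (lt_le_trans hr2 mr2).
have D0 : det2 (da u s1) (da u s2) != 0 by rewrite -sgz_eq0 Sd sgz_eq0.
move=> e2 e1; apply/eqP; rewrite -subr_eq0.
(* Elimination in the linear system of the two orthogonality relations, whose determinant is
   nonzero. *)
move: D0 e1 e2; rewrite -[a u s2 - a u s1]opprB.
case: (a u s1 - a u s2) (da u s1) (da u s2) => x y [v1 v2] [w1 w2].
rewrite /dot2 /det2 /= => D0 e1 e2.
have X : x * (v1 * w2 - v2 * w1) = 0.
  have -> : x * (v1 * w2 - v2 * w1) = (x * v1 + y * v2) * w2 + (- x * w1 + - y * w2) * v2 by ring.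
  by rewrite e1 e2 !mul0r addr0.
have Y : y * (v1 * w2 - v2 * w1) = 0.
  have -> : y * (v1 * w2 - v2 * w1) = - (x * v1 + y * v2) * w1 - (- x * w1 + - y * w2) * v1 by ring.
  by rewrite e1 e2 oppr0 !mul0r subr0.
move/eqP: X; move/eqP: Y; rewrite !mulf_eq0 (negPf D0) !orbF.
by move=> /eqP -> /eqP ->.
Qed.
End Local.
End Families.

(** * Continuation of the double points of a family *)

Section DoublePairs.
Variable R : realType.
Implicit Types (u s t e r d : R) (v w z : R * R).

Lemma square_uniform (Q : R -> R -> R -> Prop) :
  (forall t1 t2, 0 <= t1 <= 1 -> 0 <= t2 <= 1 -> exists d : R, 0 < d /\
     forall s1 s2, `|s1 - t1| < d -> `|s2 - t2| < d ->
       forall e, 0 < e < d -> Q e s1 s2) ->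
  exists d : R, 0 < d /\ forall e, 0 < e < d ->
    forall t1 t2, 0 <= t1 <= 1 -> 0 <= t2 <= 1 -> Q e t1 t2.
Proof.
move=> H.
have [|d [d0 Hd]] := @segment_uniform R 0 1
    (fun e t1 => forall t2, 0 <= t2 <= 1 -> Q e t1 t2); last first.
  by exists d; split => // e ed t1 t2 h1 h2; exact: Hd.
move=> t1 h1.
have [|d [d0 Hd]] := @segment_uniform R 0 1
    (fun e t2 => forall s1, `|s1 - t1| < e -> forall e', 0 < e' <= e -> Q e' s1 t2).
  move=> t2 h2; have [d [d0 Hd]] := H t1 t2 h1 h2; exists d; split => //.
  move=> s2 hs2 e /andP[e0 ed] s1 hs1 e' /andP[e'0 e'e]; apply: Hd => //.
    exact: lt_trans ed.
  by rewrite e'0 (le_lt_trans e'e).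
exists (d / 2); split; first lra.
move=> s1 hs1 e he t2 h2; apply: (Hd (d / 2)) => //; lra.
Qed.

Lemma finite_uniform (T : eqType) (A : set T) (P : T -> R -> Prop) :
  finite_set A -> (forall x d d', 0 < d' <= d -> P x d -> P x d') ->
  (forall x, A x -> exists d : R, 0 < d /\ P x d) ->
  exists d : R, 0 < d /\ forall x, A x -> P x d.
Proof.
move=> /finite_seqP[l ->] Pd; elim: l => [|x l IH] H; first by exists 1.
have [|d [d0 Hd]] := IH.
  by move=> y yl; apply: H; rewrite /= inE; apply/orP; right.
have [|d' [d'0 Hd']] := H x; first by rewrite /= inE eqxx.
have m0 : 0 < Num.min d d' by rewrite lt_min d0.
exists (Num.min d d'); split => // y; rewrite /= inE => /orP[/eqP->|yl].
  by apply: Pd Hd'; rewrite m0 ge_min lexx orbT.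
by apply: Pd (Hd y yl); rewrite m0 ge_min lexx.
Qed.

(** Double points are followed through their parameters rather than their positions: the ordered
    pair keeps the two branches apart and records which one is visited first. *)
Definition dpair (a : R -> R -> R * R) u : set (R * R) :=
  [set z | [/\ 0 < z.1, z.1 < z.2, z.2 < 1 & a u z.1 = a u z.2]].

Variables (a da : R -> R -> R * R) (fam : curve_family a da).

(** The dichotomy that feeds compactness of the closed square. On the diagonal pairs are excluded by
    immersivity, at the corner (0, 1) by immersivity modulo the period, and on the other sides by
    the choice of the base point. *)
Lemma dpair_local u0 t1 t2 : 0 <= t1 <= 1 -> 0 <= t2 <= 1 ->
  dpair a u0 (t1, t2) \/ exists d : R, 0 < d /\
    forall u s1 s2, `|u - u0| < d -> `|s1 - t1| < d -> `|s2 - t2| < d ->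
      ~ dpair a u (s1, s2).
Proof.
move=> h1 h2.
have chord0 t : exists d : R, 0 < d /\ forall u s s', `|u - u0| < d ->
    `|s - t| < d -> `|s' - t| < d -> a u s = a u s' -> s = s'.
  have n0 : 0 < `|da u0 t| by rewrite normr_gt0 (fam_imm fam).
  have [d [d0 Hd]] := fam_chord fam u0 t n0; exists d; split => //.
  move=> u s s' uu ss ss' E; have [D [De]] := Hd u s s' uu ss ss'.
  rewrite E subrr => /esym/eqP; rewrite scaler_eq0 subr_eq0 => /orP[/eqP//|/eqP D0].
  by move: De; rewrite D0 sub0r normrN ltxx.
have [E|E] := eqVneq (a u0 t1) (a u0 t2); last first.
  right; have n0 : 0 < `|a u0 t1 - a u0 t2| by rewrite normr_gt0 subr_eq0.
  have [d [d0 Hd]] := fam_diff_cont fam u0 t1 t2 n0; exists d; split => //.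
  move=> u s1 s2 uu ss1 ss2 [_ _ _ /= Es].
  by have := Hd u s1 s2 uu ss1 ss2; rewrite Es subrr sub0r normrN ltxx.
have [t12|t21|t12] := ltgtP t1 t2.
- have [t10|t10] := eqVneq t1 0; have [t21|t21] := eqVneq t2 1.
  (* The corner (0, 1) is the base point met twice; [s2 - 1] and [s1] are both near 0, where the
     curve is injective. *)
  + right; have [d [d0 Hd]] := chord0 0; exists d; split => //.
    move=> u s1 s2 uu; rewrite t10 t21 => ss1 ss2 [/= s10 s12 s21 Es].
    have : s1 = s2 - 1.
      apply: (Hd u) => //; first by rewrite subr0.
      by rewrite Es -[in LHS](subrK 1 s2) (fam_per fam).
    lra.
  + have t2lt : t2 < 1 by rewrite lt_neqAle t21; case/andP: h2.
    have : a u0 t2 != a u0 0 by apply: (fam_base fam); lra.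
    by rewrite -E t10 eqxx.
  + have t1gt : 0 < t1 by rewrite lt_neqAle eq_sym t10; case/andP: h1.
    have : a u0 t1 != a u0 0 by apply: (fam_base fam); lra.
    by rewrite E t21 -[X in a u0 X]add0r (fam_per fam) eqxx.
  + left; split => //=; first by rewrite lt_neqAle eq_sym t10 (andP h1).1.
    by rewrite lt_neqAle t21 (andP h2).2.
- right; exists ((t1 - t2) / 2); split; first lra.
  move=> u s1 s2 _; rewrite !ltr_norml => /andP[? ?] /andP[? ?] [/= _ ? _ _].
  lra.
- right; have [d [d0 Hd]] := chord0 t1; exists d; split => //.
  move=> u s1 s2 uu ss1 ss2 [/= _ s12 _ Es].
  have := Hd u s1 s2 uu ss1; rewrite {1}t12 => /(_ ss2 Es) E12.
  by move: s12; rewrite E12 ltxx.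
Qed.

Lemma dpair_unit u z : dpair a u z -> 0 <= z.1 <= 1 /\ 0 <= z.2 <= 1.
Proof. by case=> ? ? ? _; split; lra. Qed.

Lemma dpair_det u z : dpair a u z -> det2 (da u z.1) (da u z.2) != 0.
Proof. by case=> ? ? ? ?; exact: (fam_trans fam). Qed.

Lemma dpair_isolated u0 z0 : dpair a u0 z0 -> exists r : R, 0 < r /\
  forall u z z', `|u - u0| < r -> dpair a u z -> dpair a u z' ->
    `|z - z0| < r -> `|z' - z0| < r -> z = z'.
Proof.
move=> zu; have [r [r0 U]] := crossing_uniq fam (dpair_det zu).
exists r; split => // u [s1 s2] [s1' s2'] uu [_ _ _ /= E] [_ _ _ /= E'].
rewrite !pair_norm_lt /= => /andP[h1 h2] /andP[h1' h2'].
by have [-> ->] := U u uu _ _ _ _ h1 h2 h1' h2' E E'.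
Qed.

Lemma dpair_finite u : finite_set (dpair a u).
Proof.
pose B : set (R * R) := `[0, 1] `*` `[0, 1].
(* Near covering along this filter turns local finiteness into finiteness. *)
pose G : set_system (set (R * R)) := [set P | exists A : set (R * R),
  finite_set A /\ forall A', A `<=` A' -> P A'].
have fG : Filter G.
  split.
  - by exists set0.
  - move=> P Q [A [fA PA]] [A' [fA' QA']]; exists (A `|` A').
    split; first by rewrite finite_setU.
    by move=> C UC; split; [apply: PA|apply: QA'] => x Ax; apply: UC; [left|right].
  - by move=> P Q PQ [A [fA PA]]; exists A; split => // A' /PA /PQ.
have cB : compact B by apply: compact_setX; exact: segment_compact.
move/compact_near_coveringP: cB => /(_ _ G (fun A z => dpair a u z -> A z) fG).
case.
  move=> [t1 t2] [/=]; rewrite !in_itv /= => h1 h2.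
  have [d [d0 sub1]] : exists d : R, 0 < d /\
      is_subset1 (ball (t1, t2) d `&` dpair a u).
    have [tu|[d [d0 Hd]]] := dpair_local u h1 h2.
      have [r [r0 U]] := dpair_isolated tu; exists r; split => // z z'.
      rewrite -ball_normE /= => -[zt zu] [z't z'u].
      by apply: (U u) => //; rewrite ?subrr ?normr0 // distrC.
    exists d; split => // z z'; rewrite -ball_normE /= => -[zt zu] _; exfalso.
    move: zt; rewrite distrC pair_norm_lt /= => /andP[? ?].
    by apply: (Hd u z.1 z.2); rewrite ?subrr ?normr0 -?surjective_pairing.
  set S := _ `&` _ in sub1.
  exists (ball (t1, t2) d, [set A | S `<=` A]) => /=.
    split; first exact: nbhsx_ballx.
    have [[y yS]|nS] := pselect (exists y, S y).
      by exists [set y]; split => // A yA z /sub1/(_ yS) ->; exact: yA.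
    by exists set0; split => // A _ z zS; exfalso; apply: nS; exists z.
  by move=> [z A] [/= zt SA] zu; exact: SA.
move=> A [fA H]; apply: sub_finite_set fA => z zu; apply: (H A) => //.
by have [h1 h2] := dpair_unit zu; split; rewrite /= in_itv.
Qed.

(** No pair is born away from the old ones: by [dpair_local] every other point of the closed square,
    boundary included, has a neighbourhood free of pairs at nearby times. *)
Lemma dpair_near u0 r : 0 < r -> exists d : R, 0 < d /\ forall u, `|u - u0| < d -> forall z, dpair a u z ->
    exists z0, dpair a u0 z0 /\ `|z - z0| < r.
Proof.
move=> r0.
have [|d [d0 Hd]] := @square_uniform (fun e s1 s2 => forall u, `|u - u0| < e ->
    dpair a u (s1, s2) -> exists z0, dpair a u0 z0 /\ `|(s1, s2) - z0| < r).
  move=> t1 t2 h1 h2; have [tu|[d [d0 Hd]]] := dpair_local u0 h1 h2.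
    exists r; split => // s1 s2 hs1 hs2 e _ u _ _.
    by exists (t1, t2); split => //; rewrite pair_norm_lt hs1.
  exists d; split => // s1 s2 hs1 hs2 e /andP[e0 ed] u hu su.
  by case: (Hd u s1 s2) => //; exact: lt_trans ed.
have d2 : 0 < d / 2 < d by lra.
exists (d / 2); split; first by case/andP: d2.
move=> u hu [s1 s2] su; have [/= h1 h2] := dpair_unit su.
exact: (Hd (d / 2) d2 s1 s2 h1 h2 u hu su).
Qed.

(** The map comes from [crossing_exists], its injectivity from isolation at time [u0], its
    surjectivity from [dpair_near] and isolation at time [u]. *)
Lemma dpair_bij u0 r : 0 < r -> exists d : R, 0 < d /\
  forall u, `|u - u0| < d -> exists psi, set_bij (dpair a u0) (dpair a u) psi /\
    forall z, dpair a u0 z -> `|psi z - z| < r.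
Proof.
move=> r0.
have [||r1 [r10 U]] := @finite_uniform _ (dpair a u0) (fun z0 d => forall u z z',
    `|u - u0| < d -> dpair a u z -> dpair a u z' ->
    `|z - z0| < d -> `|z' - z0| < d -> z = z') (dpair_finite u0).
- move=> z0 d d' /andP[d'0 d'd] H u z z' hu zu z'u hz hz'.
  by apply: (H u) => //; exact: lt_le_trans d'd.
- by move=> z0 /dpair_isolated.
(* Half of [r1], so that two old pairs with a common image are within the isolation radius of each
   other. *)
have [p [p0 pr pr1]] : exists p : R, [/\ 0 < p, p <= r & p <= r1 / 2].
  by exists (Num.min r (r1 / 2)); rewrite lt_min r0 !ge_min !lexx orbT divr_gt0.
have [||d1 [d10 H1]] := @finite_uniform _ (dpair a u0) (fun z0 d => forall u,
    `|u - u0| < d -> exists z, dpair a u z /\ `|z - z0| < p) (dpair_finite u0).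
- by move=> z d d' /andP[_ d'd] H u hu; apply: H; exact: lt_le_trans d'd.
- move=> [t1 t2] tu; have [/= t10 t12 t21 Et] := tu.
  (* [q] keeps the continued pair in the open triangle 0 < s1 < s2 < 1. *)
  have [q [q0 q1 q2 q3 q4]] : exists q : R,
      [/\ 0 < q, q <= p, q <= t1, q <= (t2 - t1) / 2 & q <= 1 - t2].
    exists (Num.min p (Num.min t1 (Num.min ((t2 - t1) / 2) (1 - t2)))).
    split; [|by rewrite !ge_min !lexx ?orbT..].
    by rewrite !lt_min p0 t10 divr_gt0 ?subr_gt0.
  have [d [d0 Hd]] := crossing_exists fam Et (dpair_det tu) q0.
  exists d; split => // u hu; have [s1 [s2 [hs1 hs2 Es]]] := Hd u hu.
  exists (s1, s2); split.
    by move: hs1 hs2; rewrite !ltr_norml => /andP[? ?] /andP[? ?]; split => //=; lra.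
  by rewrite pair_norm_lt /= !(lt_le_trans _ q1).
have [d2 [d20 H2]] := dpair_near u0 p0.
exists (Num.min d1 (Num.min d2 r1)); split; first by rewrite !lt_min d10 d20.
move=> u; rewrite !lt_min => /and3P[hu1 hu2 hur].
pose psi z0 := xget z0 [set z | dpair a u z /\ `|z - z0| < p].
have psiP z0 : dpair a u0 z0 -> dpair a u (psi z0) /\ `|psi z0 - z0| < p.
  move=> /H1/(_ u hu1) H.
  exact: (@xgetPex _ z0 [set z | dpair a u z /\ `|z - z0| < p] H).
exists psi; split; last first.
  by move=> z zu; exact: lt_le_trans (psiP z zu).2 pr.
split.
- by move=> z zu; exact: (psiP z zu).1.
- move=> z z' /set_mem zu /set_mem z'u E.
  have [_ h] := psiP z zu; have [_ h'] := psiP z' z'u.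
  apply: (U z zu u0) => //; rewrite ?subrr ?normr0 //.
  rewrite -(subrK (psi z') z') -addrA (le_lt_trans (ler_normD _ _)) //.
  by rewrite distrC -{2}E; lra.
- move=> z zu; have [z0 [z0u hz]] := H2 u hu2 z zu; exists z0 => //.
  have [h1 h2] := psiP z0 z0u.
  by apply: (U z0 z0u u) => //; lra.
Qed.

(** Times on both sides of [u0] are compared through [u0] itself, with different summands allowed at
    [u] and [u']: this is the situation at a triple point. *)
Lemma dpair_sum u0 r : 0 < r -> exists d : R, 0 < d /\ forall u u', `|u - u0| < d -> `|u' - u0| < d -> forall F F' : R * R -> int,
    (forall z0 z z', dpair a u0 z0 -> dpair a u z -> dpair a u' z' ->
       `|z - z0| < r -> `|z' - z0| < r -> F z = F' z') ->
    \sum_(z \in dpair a u) F z = \sum_(z \in dpair a u') F' z.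
Proof.
move=> r0; have [d [d0 Hd]] := dpair_bij u0 r0; exists d; split => //.
move=> u u' /Hd[psi [bpsi hpsi]] /Hd[psi' [bpsi' hpsi']] F F' FF'.
rewrite (reindex_fsbig psi _ _ F bpsi) (reindex_fsbig psi' _ _ F' bpsi').
apply: eq_fsbigr => z /set_mem zu; apply: (FF' z) => //.
- by case: bpsi => f _ _; exact: f.
- by case: bpsi' => f _ _; exact: f.
- exact: hpsi.
- exact: hpsi'.
Qed.
End DoublePairs.

(** * Jumps at a triple point *)

Section WindingStability.
Variable R : realType.
Implicit Types (u s t e r d : R) (v w x z : R * R).
Variables (c dc : R -> R -> R * R) (fam : curve_family c dc).

Lemma fam_loop u x : (forall t, c u t != x) -> loop (fun t => c u t - x).
Proof.
move=> cx; split => t; last by rewrite subr_eq0.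
  by apply: cvgB; [exact: (fam_continuous fam)|exact: cvg_cst].
by rewrite (fam_per fam).
Qed.

Lemma fam_reduce s t : exists t', s <= t' < s + 1 /\ forall u, c u t = c u t'.
Proof.
pose n := Num.floor (t - s); exists (t - n%:~R); split.
  by have := Num.Theory.floor_itv (t - s); rewrite -/n intrD; lra.
by move=> u; rewrite -[RHS](periodicz _ n (fam_per fam u)) subrK.
Qed.

Lemma fam_sub_cont u0 t0 x0 e : 0 < e -> exists d : R, 0 < d /\
  forall u t x, `|u - u0| < d -> `|t - t0| < d -> `|x - x0| < d ->
    `|(c u t - x) - (c u0 t0 - x0)| < e.
Proof.
move=> e0; have e2 : 0 < e / 2 by lra.
have [d [d0 Hd]] := fam_cont fam u0 t0 e2.
exists (Num.min d (e / 2)); split; first by rewrite lt_min d0.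
move=> u t x; rewrite !lt_min => /andP[hu _] /andP[ht _] /andP[_ hx].
have -> : c u t - x - (c u0 t0 - x0) = (c u t - c u0 t0) - (x - x0).
  by rewrite !opprB addrACA [RHS]addrACA; congr (_ + _); rewrite addrC.
by rewrite (le_lt_trans (ler_normB _ _)) // [ltRHS](splitr e) ltrD ?Hd.
Qed.

Lemma fam_dot_pos u0 x0 (a b : R) : (forall t, a <= t <= b -> c u0 t != x0) ->
  exists d : R, 0 < d /\ forall u u' x x', `|u - u0| < d -> `|u' - u0| < d ->
    `|x - x0| < d -> `|x' - x0| < d ->
    forall t, a <= t <= b -> 0 < dot2 (c u t - x) (c u' t - x').
Proof.
move=> cx.
have [|d [d0 Hd]] := @segment_uniform R a b (fun e t => forall u u' x x',
    `|u - u0| < e -> `|u' - u0| < e -> `|x - x0| < e -> `|x' - x0| < e ->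
    0 < dot2 (c u t - x) (c u' t - x')).
  move=> t tab; have n0 : c u0 t - x0 != 0 by rewrite subr_eq0 cx.
  have [e [e0 He]] := dot2_pert (dot2_gt0 n0).
  have [d [d0 Hd]] := fam_sub_cont u0 t x0 e0.
  exists d; split => // t' ht' e' /andP[e'0 e'd] u u' x x' hu hu' hx hx'.
  by apply: He; apply: Hd => //; exact: lt_trans e'd.
have d2 : 0 < d / 2 < d by lra.
exists (d / 2); split; first by case/andP: d2.
by move=> u u' x x' hu hu' hx hx' t tab; exact: (Hd (d / 2) d2 t tab).
Qed.

Lemma wn_stable u0 x0 : (forall t, c u0 t != x0) -> exists d : R, 0 < d /\
  forall u x, `|u - u0| < d -> `|x - x0| < d -> (forall t, c u t != x) /\
    wn (fun t => c u t - x) = wn (fun t => c u0 t - x0).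
Proof.
move=> cx; have [|d [d0 Hd]] := @fam_dot_pos u0 x0 0 1; first by move=> t _.
exists d; split => // u x hu hx.
have H u' x' t : `|u' - u0| < d -> `|x' - x0| < d ->
    0 < dot2 (c u t - x) (c u' t - x').
  move=> hu' hx'; have [t' [t'1 E]] := fam_reduce 0 t; rewrite !E.
  by apply: Hd => //; lra.
have cx' t : c u t != x.
  have := H u x t hu hx; apply: contraTneq => ->.
  by rewrite subrr /dot2 !mulr0 addr0 ltxx.
split => //; apply: wn_dot; [exact: fam_loop|exact: fam_loop|] => t.
by apply: H; rewrite subrr normr0.
Qed.

(** The determinant expanded in the orthogonal frame formed by [x] and its rotation by a right
    angle. *)
Lemma dot2_det2 x v w : dot2 x x * det2 v w =
  dot2 x v * det2 x w - det2 x v * dot2 x w :> R.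
Proof. by rewrite /dot2 /det2; ring. Qed.

Lemma dot2Zr k v w : dot2 v (k *: w) = k * dot2 v w :> R.
Proof. by rewrite /dot2 /= /GRing.scale /=; ring. Qed.

Lemma dot2Nl v w : dot2 (- v) w = - dot2 v w :> R.
Proof. by rewrite /dot2 /=; ring. Qed.

Lemma dot2C v w : dot2 v w = dot2 w v :> R.
Proof. by rewrite /dot2 mulrC (mulrC v.2). Qed.

Lemma dot2r0 v : dot2 v 0 = 0 :> R.
Proof. by rewrite /dot2 /= !mulr0 addr0. Qed.

Lemma det2r0 v : det2 v 0 = 0 :> R.
Proof. by rewrite /det2 /= !mulr0 subr0. Qed.

Lemma det2Bl v w x : det2 (v - w) x = det2 v x - det2 w x :> R.
Proof. by rewrite /det2 /=; ring. Qed.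

(* The points c u t and c u' t' of the branches lie on opposite sides of p and
   p' in the direction v, so these branches pass p and p' on opposite sides. *)
Lemma wn_jump_pos u0 s v : (forall t, c u0 t = c u0 s -> same_param t s) ->
  0 < det2 v (dc u0 s) -> exists e : R, 0 < e /\
  forall u u' p p' t t' k k' D D', `|u - u0| < e -> `|u' - u0| < e ->
    `|p - c u0 s| < e -> `|p' - c u0 s| < e -> `|t - s| < e -> `|t' - s| < e ->
    0 < k -> 0 < k' -> `|D - v| < e -> `|D' - v| < e ->
    c u' t' - p' = k' *: D' -> c u t - p = - (k *: D) ->
    wn (fun t => c u' t - p') = wn (fun t => c u t - p) + 1.
Proof.
move=> us vd; set d := dc u0 s in vd *.
have d0 : d != 0 by exact: (fam_imm fam).
have dd := dot2_gt0 d0.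
have [e1 [e10 He1]] := dot2_pert dd.
have [e2 [e20 He2]] := det2_pert vd.
have e12 : 0 < Num.min e1 e2 by rewrite lt_min e10.
have [w0 [w00 Hw0]] := fam_chord fam u0 s e12.
(* [w < w0] keeps the short arc where chords are controlled, [w < 1 / 2] leaves a long arc to
   complete the period. *)
have [w [w1 w2 w3]] : exists w : R, [/\ 0 < w, w < w0 & w < 1 / 2].
  by case: (leP w0 (1 / 4)) => ?; [exists (w0 / 2)|exists (1 / 4)]; split; lra.
have near_s t : s - w <= t <= s + w -> `|t - s| < w0 by rewrite ltr_norml; lra.
have chord u t t' : `|u - u0| < w0 -> `|t - s| < w0 -> `|t' - s| < w0 ->
    exists D, [/\ 0 < dot2 d D, forall D', `|D' - v| < e2 -> 0 < det2 D' D
      & c u t - c u t' = (t - t') *: D].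
  move=> hu ht ht'; have [D []] := Hw0 u t t' hu ht ht'.
  rewrite lt_min => /andP[h1 h2] E; exists D; split => //.
    by apply: He1 => //; rewrite subrr normr0.
  by move=> D' hD'; exact: He2.
have s0 : `|s - s| < w0 by rewrite subrr normr0.
have u00 : `|u0 - u0| < w0 by rewrite subrr normr0.
have end1 : 0 < dot2 d (c u0 (s + w) - c u0 s).
  have [|D [dD _ ->]] := chord u0 (s + w) s u00 _ s0.
    by apply: near_s; lra.
  by rewrite addrAC subrr add0r dot2Zr mulr_gt0.
have end2 : 0 < dot2 (- d) (c u0 (s - w) - c u0 s).
  have [|D [dD _ ->]] := chord u0 (s - w) s u00 _ s0.
    by apply: near_s; lra.
  by rewrite addrAC subrr add0r dot2Zr dot2Nl mulNr mulrN opprK mulr_gt0.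
have [e3 [e30 He3]] := dot2_pert end1.
have [e4 [e40 He4]] := dot2_pert end2.
have [d3 [d30 Hd3]] := fam_sub_cont u0 (s + w) (c u0 s) e30.
have [d4 [d40 Hd4]] := fam_sub_cont u0 (s - w) (c u0 s) e40.
(* The curve does not return to [c u0 s] on the long arc: a return would give an integer strictly
   between 0 and 1. *)
have [|d5 [d50 Hd5]] := @fam_dot_pos u0 (c u0 s) (s + w) (s + 1 - w).
  move=> t tI; apply/eqP => /us; rewrite /same_param => /Num.Theory.intrP[n nE].
  have : 0 < n%:~R :> R by lra.
  have : n%:~R < 1 :> R by lra.
  by rewrite -[1]/(1%:~R) ltr_int -[0]/(0%:~R) ltr_int; case: n {nE} => [[|[]]|].
exists (Num.min (Num.min w0 e2) (Num.min d3 (Num.min d4 d5))).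
split; first by rewrite !lt_min w00 e20 d30 d40.
move=> u u' p p' t t' k k' D D'; rewrite !lt_min.
move=> /and3P[/andP[uw _] ud3 /andP[ud4 ud5]].
move=> /and3P[/andP[u'w _] u'd3 /andP[u'd4 u'd5]].
move=> /and3P[_ pd3 /andP[pd4 pd5]] /and3P[_ p'd3 /andP[p'd4 p'd5]].
move=> /and3P[/andP[tw _] _ _] /and3P[/andP[t'w _] _ _] k0 k'0.
move=> /and3P[/andP[_ De] _ _] /and3P[/andP[_ D'e] _ _] E' E.
(* The chord [G] from [y] to [t'] is nearly parallel to [d], so [c u' y - p'] and [k' *: D'] have
   the same positive determinant with [G]. By [dot2_det2], a vector orthogonal to [d] and weakly to
   its left would make that determinant nonpositive. *)
have side' y : s - w <= y <= s + w -> dot2 d (c u' y - p') = 0 ->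
    det2 d (c u' y - p') < 0.
  move=> /near_s yI dq; rewrite ltNge; apply/negP => dtq.
  have [G [dG DG EG]] := chord u' t' y u'w t'w yI.
  have : det2 ((c u' t' - p') - (c u' y - p')) G = 0.
    by rewrite opprB addrA subrK EG det2Zl det2vv mulr0.
  rewrite det2Bl E' det2Zl.
  have h1 : 0 < k' * det2 D' G by rewrite mulr_gt0 // DG.
  have : dot2 d d * det2 (c u' y - p') G <= 0.
    by rewrite dot2_det2 dq mul0r sub0r oppr_le0 mulr_ge0 // ltW.
  by rewrite pmulr_rle0 //; lra.
have side y : s - w <= y <= s + w -> dot2 d (c u y - p) = 0 ->
    0 < det2 d (c u y - p).
  move=> /near_s yI dq; rewrite ltNge; apply/negP => dtq.
  have [G [dG DG EG]] := chord u t y uw tw yI.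
  have : det2 ((c u t - p) - (c u y - p)) G = 0.
    by rewrite opprB addrA subrK EG det2Zl det2vv mulr0.
  rewrite det2Bl E -scaleNr det2Zl.
  have h1 : 0 < k * det2 D G by rewrite mulr_gt0 // DG.
  have : 0 <= dot2 d d * det2 (c u y - p) G.
    by rewrite dot2_det2 dq mul0r sub0r -mulNr mulr_ge0 ?oppr_ge0 // ltW.
  by rewrite pmulr_rge0 //; lra.
have long y : s + w <= y <= s + 1 - w -> 0 < dot2 (c u y - p) (c u' y - p').
  by move=> yI; exact: Hd5.
have avoid u1 p1 : (forall y, s - w <= y <= s + w -> c u1 y != p1) ->
    (forall y, s + w <= y <= s + 1 - w -> c u1 y != p1) -> loop (fun y => c u1 y - p1).
  move=> h1 h2; apply: fam_loop => y; have [y' [yI ->]] := fam_reduce (s - w) y.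
  by have [yl|yl] := leP y' (s + w); [apply: h1|apply: h2]; lra.
have Z (x e : R) : 0 < e -> `|x - x| < e by rewrite subrr normr0.
have Zd e : 0 < e -> `|d - d| < e by rewrite subrr normr0.
have ends u1 p1 : `|u1 - u0| < d3 -> `|u1 - u0| < d4 -> `|p1 - c u0 s| < d3 ->
    `|p1 - c u0 s| < d4 -> dot2 d (c u1 (s - w) - p1) < 0 < dot2 d (c u1 (s + w) - p1).
  move=> u1d3 u1d4 p1d3 p1d4; apply/andP; split.
    have ZN : `|- d - - d| < e4 by rewrite subrr normr0.
    by have := He4 _ _ ZN (Hd4 _ _ _ u1d4 (Z _ _ d40) p1d4); rewrite dot2Nl oppr_gt0.
  exact: He3 (Zd _ e30) (Hd3 _ _ _ u1d3 (Z _ _ d30) p1d3).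
apply: (@wn_crossing R _ _ d s w) => //.
- apply: avoid => y yI; rewrite -subr_eq0; apply/eqP => y0.
    by have := side' y yI; rewrite y0 dot2r0 det2r0 ltxx => /(_ erefl).
  by have := long y yI; rewrite y0 dot2r0 ltxx.
- apply: avoid => y yI; rewrite -subr_eq0; apply/eqP => y0.
    by have := side y yI; rewrite y0 dot2r0 det2r0 ltxx => /(_ erefl).
  by have := long y yI; rewrite y0 dot2C dot2r0 ltxx.
- by rewrite w1.
- exact: ends.
- exact: ends.
Qed.
End WindingStability.

(** * The jump of the sum over double points *)

Section Jump.
Variable R : realType.
Implicit Types (u s t : R) (v w z : R * R).

(** The signed form of [wn_jump_pos]: exchanging the two times changes the sign of [l'], replacing
    [v] by its opposite changes that of the determinant. The condition [l * l' < 0] says that the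
    point really changes sides. *)
Lemma wn_jump (c dc : R -> R -> R * R) u0 s v : curve_family c dc ->
  (forall t, c u0 t = c u0 s -> same_param t s) ->
  det2 v (dc u0 s) != 0 -> exists e : R, 0 < e /\
  forall u u' p p' t t' l l' D D', `|u - u0| < e -> `|u' - u0| < e ->
    `|p - c u0 s| < e -> `|p' - c u0 s| < e -> `|t - s| < e -> `|t' - s| < e ->
    `|D - v| < e -> `|D' - v| < e -> l * l' < 0 ->
    c u' t' - p' = l' *: D' -> c u t - p = l *: D ->
    wn (fun t => c u' t - p') - wn (fun t => c u t - p) =
      sgz l' * sgz (det2 v (dc u0 s)).
Proof.
move=> fam us.
have pos w : 0 < det2 w (dc u0 s) -> exists e : R, 0 < e /\
    forall u u' p p' t t' l l' D D', `|u - u0| < e -> `|u' - u0| < e ->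
    `|p - c u0 s| < e -> `|p' - c u0 s| < e -> `|t - s| < e -> `|t' - s| < e ->
    `|D - w| < e -> `|D' - w| < e -> l * l' < 0 ->
    c u' t' - p' = l' *: D' -> c u t - p = l *: D ->
    wn (fun t => c u' t - p') - wn (fun t => c u t - p) = sgz l'.
  move=> /(wn_jump_pos fam us)[e [e0 H]]; exists e; split => //.
  move=> u u' p p' t t' l l' D D' h1 h2 h3 h4 h5 h6 h7 h8 ll E' E.
  have [l0|l0|l0] := ltgtP l' 0; last by move: ll; rewrite l0 mulr0 ltxx.
    have l1 : 0 < l by rewrite -(nmulr_llt0 _ l0).
    rewrite ltr0_sgz // (H u' u p' p t' t (- l') l D' D) ?oppr_gt0 //.
      by rewrite opprD addrA subrr sub0r.
    by rewrite scaleNr opprK.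
  have l1 : l < 0 by rewrite -(pmulr_llt0 _ l0).
  rewrite gtr0_sgz // (H u u' p p' t t' (- l) l' D D') ?oppr_gt0 //.
    by rewrite addrAC subrr add0r.
  by rewrite scaleNr opprK.
rewrite neq_lt => /orP[vd|vd]; last first.
  have [e [e0 H]] := pos v vd; exists e; split => //.
  move=> u u' p p' t t' l l' D D' h1 h2 h3 h4 h5 h6 h7 h8 ll E' E.
  by rewrite (gtr0_sgz vd) mulr1; exact: (H u u' p p' t t' l l' D D').
have [|e [e0 H]] := pos (- v).
  by rewrite -scaleN1r det2Zl mulN1r oppr_gt0.
exists e; split => //.
move=> u u' p p' t t' l l' D D' h1 h2 h3 h4 h5 h6 h7 h8 ll E' E.
rewrite (ltr0_sgz vd) mulrN1 -sgzN.
apply: (H u u' p p' t t' (- l) (- l') (- D) (- D')) => //.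
- by rewrite -opprD normrN.
- by rewrite -opprD normrN.
- by rewrite mulrNN.
- by rewrite scaleNr scalerN opprK.
- by rewrite scaleNr scalerN opprK.
Qed.

(** One summand e(p) ind(p) of the formula: the determinant takes the two tangents in the order of
    visits from the base point. *)
Definition dterm (a da c : R -> R -> R * R) u z : int :=
  sgz (det2 (da u z.1) (da u z.2)) * wn (fun t => c u t - a u z.1).

Definition dsum (a da c : R -> R -> R * R) u : int :=
  \sum_(z \in dpair a u) dterm a da c u z.

Variables (a da c dc : R -> R -> R * R).
Hypotheses (fa : curve_family a da) (fc : curve_family c dc).

Lemma dterm_stable u0 z0 : dpair a u0 z0 -> (forall t, c u0 t != a u0 z0.1) ->
  exists d : R, 0 < d /\ forall u z, `|u - u0| < d -> `|z - z0| < d ->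
    dterm a da c u z = dterm a da c u0 z0.
Proof.
move=> zu cz; have [d1 [d10 H1]] := fam_det_sgz fa (dpair_det fa zu).
have [d2 [d20 H2]] := wn_stable fc cz.
have [d3 [d30 H3]] := fam_cont fa u0 z0.1 d20.
exists (Num.min d1 (Num.min d2 d3)); split; first by rewrite !lt_min d10 d20.
move=> u z; rewrite !lt_min => /and3P[u1 u2 u3] /and3P[].
rewrite !pair_norm_lt /= => /andP[z11 z12] _ /andP[z31 _].
by rewrite /dterm H1 // (H2 u _ _ _).2 // H3.
Qed.

(** The hypothesis only keeps double points of [a] off [c]; tangencies between the two curves are
    allowed. *)
Lemma dsum_stable u0 :
  (forall z t, dpair a u0 z -> c u0 t != a u0 z.1) ->
  exists d : R, 0 < d /\ forall u, `|u - u0| < d ->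
    dsum a da c u = dsum a da c u0.
Proof.
move=> cz.
have [||r [r0 H]] := @finite_uniform _ _ (dpair a u0) (fun z0 d => forall u z,
    `|u - u0| < d -> `|z - z0| < d -> dterm a da c u z = dterm a da c u0 z0)
    (dpair_finite fa u0).
- move=> z0 d d' /andP[_ d'd] H u z h1 h2; apply: H; exact: lt_le_trans d'd.
- by move=> z0 zu; apply: dterm_stable => // t; exact: cz.
have [d [d0 Hd]] := dpair_sum fa u0 r0.
exists (Num.min d r); split; first by rewrite lt_min d0.
move=> u; rewrite lt_min => /andP[ud ur].
apply: Hd => //; first by rewrite subrr normr0.
move=> z0 z z' z0u zu z'u hz hz'; rewrite (H z0 z0u u z) // (H z0 z0u u0 z') //.
by rewrite subrr normr0.
Qed.

(* Edges [x0, y0] and [x1, y1] of a near the double pair z, edge [x2, y2] of c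
   near s, traversed cyclically. *)
Definition small_triangle u z s (e x0 y0 x1 y1 x2 y2 : R) : Prop :=
  [/\ [/\ `|x0 - z.1| < e, `|y0 - z.1| < e, `|x1 - z.2| < e & `|y1 - z.2| < e],
      `|x2 - s| < e, `|y2 - s| < e, [/\ x0 != y0, x1 != y1 & x2 != y2]
    & [/\ a u y0 = a u x1, a u y1 = c u x2 & c u y2 = a u x0]].

Lemma sgz_sqr1 (l : R) : l != 0 -> sgz l * sgz l = 1.
Proof. by rewrite sgz_def => ->; case: ltgtP. Qed.

Lemma ordered_near (t1 t2 x y m : R) :
  m <= t1 -> m <= (t2 - t1) / 2 -> m <= 1 - t2 ->
  `|x - t1| < m -> `|y - t2| < m -> [/\ 0 < x, x < y & y < 1].
Proof.
by move=> ? ? ?; rewrite !ltr_norml => /andP[? ?] /andP[? ?]; split; lra.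
Qed.

(** Only the term of the pair near [z0] changes, and in it only the winding number. Its jump is the
    sign of edge 1 times that of [det2 (da u0 z0.2) (dc u0 s)]. The product of this determinant with
    the one of the double point has the sign of edges 0 and 2 multiplied, by the closing relation of
    the triangle. *)
Lemma dsum_jump u0 z0 s : dpair a u0 z0 -> c u0 s = a u0 z0.1 ->
  (forall z t, dpair a u0 z -> c u0 t = a u0 z.1 -> z = z0 /\ same_param t s) ->
  det2 (da u0 z0.2) (dc u0 s) != 0 ->
  exists e : R, 0 < e /\ forall u u', `|u - u0| < e -> `|u' - u0| < e ->
  forall x0 y0 x1 y1 x2 y2 x0' y0' x1' y1' x2' y2',
    small_triangle u z0 s e x0 y0 x1 y1 x2 y2 ->
    small_triangle u' z0 s e x0' y0' x1' y1' x2' y2' ->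
    (x1 < y1) = ~~ (x1' < y1') ->
    dsum a da c u' - dsum a da c u =
      sgz (y0' - x0') * sgz (y1' - x1') * sgz (y2' - x2').
Proof.
move=> zu cs only dt12; have dt01 := dpair_det fa zu.
have only_s t : c u0 t = c u0 s -> same_param t s.
  by move=> E; apply: (only z0 t zu _).2; rewrite E.
have [||r1 [r10 H1]] := @finite_uniform _ _ (dpair a u0 `\ z0) (fun z1 d =>
    forall u z, `|u - u0| < d -> `|z - z1| < d ->
    dterm a da c u z = dterm a da c u0 z1) (finite_setD _ (dpair_finite fa u0)).
- move=> z1 d d' /andP[_ d'd] H u z h1 h2; apply: H; exact: lt_le_trans d'd.
- move=> z1 [z1u z10]; apply: dterm_stable => // t; apply/eqP => /(only z1 t z1u).
  by case=> /z10.
have [r2 [r20 H2]] := dpair_isolated fa zu.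
have [d1 [d10 J]] := wn_jump fc only_s dt12.
have [d2 [d20 H3]] := fam_det_sgz fa dt01.
have [d3 [d30 H4]] := fam_cont fa u0 z0.1 d10.
have [e1 [e10 P1]] := det2_sgz_pert dt01.
have [e2 [e20 P2]] := det2_sgz_pert dt12.
have me : 0 < Num.min e1 (Num.min e2 d1) by rewrite !lt_min e10 e20.
have [d4 [d40 C0]] := fam_chord fa u0 z0.1 me.
have [d5 [d50 C1]] := fam_chord fa u0 z0.2 me.
have [d6 [d60 C2]] := fam_chord fc u0 s me.
have [r [r0 rr1 rr2]] : exists r : R, [/\ 0 < r, r <= r1 & r <= r2 / 2].
  by exists (Num.min r1 (r2 / 2)); rewrite lt_min r10 divr_gt0 // !ge_min !lexx orbT.
have [d7 [d70 H7]] := dpair_sum fa u0 r0.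
have r2r : r < r2 by rewrite (le_lt_trans rr2) // gtr_pMr // invf_lt1 // ltr1n.
have [z01 z012 z02 _] := zu.
have [m [m0 m1 m2 m3]] : exists m : R,
    [/\ 0 < m, m <= z0.1, m <= (z0.2 - z0.1) / 2 & m <= 1 - z0.2].
  exists (Num.min z0.1 (Num.min ((z0.2 - z0.1) / 2) (1 - z0.2))).
  by rewrite !lt_min z01 divr_gt0 ?subr_gt0 // !ge_min !lexx !orbT.
exists (Num.min m (Num.min r (Num.min r1 (Num.min d1 (Num.min d2 (Num.min d3
  (Num.min d4 (Num.min d5 (Num.min d6 d7))))))))).
split; first by rewrite !lt_min m0 r0 r10 d10 d20 d30 d40 d50 d60.
set e := Num.min _ _.
have le_e : [/\ e <= m, e <= r, e <= r1 & e <= d1] /\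
    [/\ e <= d2, e <= d3, e <= d4, e <= d5 & (e <= d6) && (e <= d7)].
  by rewrite /e !ge_min !lexx !orbT.
clearbody e; case: le_e => -[em er er1 ed1] [ed2 ed3 ed4 ed5 /andP[ed6 ed7]].
move=> u u' hu hu' x0 y0 x1 y1 x2 y2 x0' y0' x1' y1' x2' y2'.
have lt_e (k l : R) : k < e -> e <= l -> k < l by move=> h1 h2; exact: lt_le_trans h2.
(* The common vertex of edges 0 and 1 is the continuation of [z0]; the bound [m] keeps its
   parameters ordered inside ]0, 1[. *)
have vertex (w X0 Y0 X1 Y1 X2 Y2 : R) : small_triangle w z0 s e X0 Y0 X1 Y1 X2 Y2 ->
    dpair a w (Y0, X1) /\ `|(Y0, X1) - z0| < e.
  case=> -[_ hY0 hX1 _] _ _ _ [E _ _]; rewrite pair_norm_lt hY0 hX1; split => //.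
  have [? ? ?] := ordered_near m1 m2 m3 (lt_e _ _ hY0 em) (lt_e _ _ hX1 em).
  by split.
move=> T T'; have [zt ht] := vertex _ _ _ _ _ _ _ T.
have [zt' ht'] := vertex _ _ _ _ _ _ _ T'.
case: T T' => [[hx0 hy0 hx1 hy1] hx2 hy2 [n0 n1 n2] [E01 E12 E20]].
move=> [[hx0' hy0' hx1' hy1'] hx2' hy2' [n0' n1' n2'] [E01' E12' E20']] opp.
(* Cancelling the exceptional term instead of removing its pair keeps the index set [dpair a w], as
   [dpair_sum] requires. *)
pose drop (w : R) (z1 z : R * R) := if z == z1 then 0 else dterm a da c w z.
have split_sum (w : R) z1 : dpair a w z1 -> dsum a da c w =
    dterm a da c w z1 + \sum_(z \in dpair a w) drop w z1 z.
  move=> z1w; rewrite /dsum (fsbigD1 z1) //=; last exact: (dpair_finite fa).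
  rewrite [in RHS](fsbigD1 z1) //=; last exact: (dpair_finite fa).
  rewrite {1}/drop eqxx add0r; congr (_ + _).
  by apply: eq_fsbigr => z; rewrite inE => -[_ /eqP/negPf]; rewrite /drop => ->.
rewrite (split_sum u _ zt) (split_sum u' _ zt').
have -> : \sum_(z \in dpair a u) drop u (y0, x1) z =
    \sum_(z \in dpair a u') drop u' (y0', x1') z.
  apply: H7; [exact: lt_e ed7|exact: lt_e ed7|].
  move=> z1 z z' z1u zw z'w hz hz'.
  have [z10|/eqP z10] := eqVneq z1 z0.
    have zE : z = (y0, x1).
      apply: (H2 u) => //; first exact: lt_e hu (le_trans er (ltW r2r)).
        by rewrite -z10; exact: lt_trans r2r.
      exact: lt_e ht (le_trans er (ltW r2r)).
    have z'E : z' = (y0', x1').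
      apply: (H2 u') => //; first exact: lt_e hu' (le_trans er (ltW r2r)).
        by rewrite -z10; exact: lt_trans r2r.
      exact: lt_e ht' (le_trans er (ltW r2r)).
    by rewrite /drop zE z'E !eqxx.
  have far (y yt : R * R) : `|y - z1| < r -> `|yt - z0| < e -> (y == yt) = false.
    move=> h1 h2; apply/eqP => yyt; apply: z10; apply: (H2 u0) => //.
    - by rewrite subrr normr0.
    - rewrite -(subrK y z1) -addrA (le_lt_trans (ler_normD _ _)) // distrC.
      apply: (lt_le_trans (ltrD h1 _)); first by rewrite yyt; exact: lt_e h2 er.
      by rewrite [leRHS]splitr lerD.
    - by rewrite subrr normr0.
  rewrite /drop (far z (y0, x1)) // (far z' (y0', x1')) //.
  rewrite (H1 z1 _ u z) //; [|exact: lt_e er1|exact: lt_le_trans hz rr1].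
  by rewrite (H1 z1 _ u' z') //; [exact: lt_e er1|exact: lt_le_trans hz' rr1].
rewrite opprD addrACA subrr addr0.
rewrite /dterm /=.
rewrite H3; [|exact: lt_e ed2..].
rewrite (H3 u); [|exact: lt_e ed2..].
rewrite -mulrBr.
have [G0 []] := C0 u' y0' x0' (lt_e _ _ hu' ed4) (lt_e _ _ hy0' ed4) (lt_e _ _ hx0' ed4).
rewrite !lt_min => /and3P[G01 _ _] EG0.
have [G1 []] := C1 u' y1' x1' (lt_e _ _ hu' ed5) (lt_e _ _ hy1' ed5) (lt_e _ _ hx1' ed5).
rewrite !lt_min => /and3P[G11 G12 G1d] EG1.
have [K1 []] := C1 u y1 x1 (lt_e _ _ hu ed5) (lt_e _ _ hy1 ed5) (lt_e _ _ hx1 ed5).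
rewrite !lt_min => /and3P[_ _ K1d] EK1.
have [G2 []] := C2 u' y2' x2' (lt_e _ _ hu' ed6) (lt_e _ _ hy2' ed6) (lt_e _ _ hx2' ed6).
rewrite !lt_min => /and3P[_ G22 _] EG2.
(* Edge 1 leads from the double point to the branch of [c], along a chord close to [da u0 z0.2]; its
   reversal from [u] to [u'] carries the double point across that branch. *)
rewrite (J u u' (a u y0) (a u' y0') x2 x2' (y1 - x1) (y1' - x1') K1 G1) //; first last.
- by rewrite -E12 E01.
- by rewrite -E12' E01'.
- move: opp n1 n1'; case: (ltgtP x1 y1) => // h; case: (ltgtP x1' y1') => // h' _ _ _.
    by rewrite pmulr_rlt0 ?subr_lt0 // subr_gt0.
  by rewrite nmulr_rlt0 ?subr_gt0 // subr_lt0.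
- exact: lt_e ed1.
- exact: lt_e ed1.
- by rewrite cs; apply: H4; exact: lt_e ed3.
- by rewrite cs; apply: H4; exact: lt_e ed3.
- exact: lt_e ed1.
- exact: lt_e ed1.
rewrite -(P2 _ _ G12 G22) -(P1 _ _ G01 G11).
have closed : (y0' - x0') *: G0 + (y1' - x1') *: G1 + (y2' - x2') *: G2 = 0.
  have cyc (p q r' : R * R) : (p - q) + (r' - p) + (q - r') = 0.
    by rewrite (addrC (p - q)) [X in X + _]addrA subrK addrA subrK subrr.
  by rewrite -EG0 -EG1 -EG2 E01' E12' E20' cyc.
(* The determinant of the closing relation with [G1] eliminates edge 1 and compares the other
   two. *)
have rel : (y0' - x0') * det2 G0 G1 = (y2' - x2') * det2 G1 G2.
  have := congr1 (fun v => det2 v G1) closed.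
  have -> : det2 0 G1 = 0 by rewrite /det2 !mul0r subrr.
  have det2Dl (p q x : R * R) : det2 (p + q) x = det2 p x + det2 q x.
    by rewrite /det2 /=; ring.
  rewrite !det2Dl !det2Zl det2vv mulr0 addr0 => /eqP.
  have -> : det2 G2 G1 = - det2 G1 G2 by rewrite /det2; ring.
  by rewrite mulrN subr_eq0 => /eqP.
have sq1 (g h : R * R) : sgz (det2 g h) != 0 -> sgz (det2 g h) * sgz (det2 g h) = 1.
  by rewrite sgz_eq0; exact: sgz_sqr1.
have : sgz (det2 G0 G1) * sgz (det2 G0 G1) = 1.
  by apply: sq1; rewrite (P1 _ _ G01 G11) sgz_eq0.
move/(congr1 (@sgz R)): rel; rewrite !sgzM.
have := sgz_sqr1 (l := y2' - x2'); rewrite subr_eq0 eq_sym => /(_ n2').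
move: (sgz (det2 G0 G1)) (sgz (det2 G1 G2)) (sgz (y0' - x0')) (sgz (y1' - x1'))
  (sgz (y2' - x2')) => A B k0 k1 k2 k22 rel AA.
have -> : A * (k1 * B) = k1 * A * (k2 * B) * k2.
  by transitivity (A * (k1 * B) * (k2 * k2)); [rewrite k22 mulr1|ring].
by rewrite -rel; transitivity (k0 * k1 * k2 * (A * A)); [ring|rewrite AA mulr1].
Qed.
End Jump.

(** * Separating homotopies *)

Section FromHomotopy.
Variable R : realType.
Implicit Types (u s t : R) (c : R -> R * R).

Lemma is_derive_fst c t : derivable c t 1 ->
  is_derive t 1 (fun s => (c s).1) (derive1 c t).1.
Proof.
rewrite derive1E => dc.
have := dc; rewrite /derivable => /cvg_ex[l cl].
have lE : 'D_1 c t = l by apply: cvg_lim cl; exact: norm_hausdorff.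
have c1 : h^-1 *: ((c (h *: (1 : R) + t)).1 - (c t).1) @[h --> 0^'] --> l.1.
  have := cvg_comp _ _ cl (_ : fst @ nbhs l --> nbhs l.1); apply.
  by case: (l) => x y; exact: (@cvg_fst _ _ (nbhs x) (nbhs y)).
split; first by apply/cvg_ex; exists l.1.
by rewrite lE; apply: cvg_lim c1; exact: norm_hausdorff.
Qed.

Lemma is_derive_snd c t : derivable c t 1 ->
  is_derive t 1 (fun s => (c s).2) (derive1 c t).2.
Proof.
rewrite derive1E => dc.
have := dc; rewrite /derivable => /cvg_ex[l cl].
have lE : 'D_1 c t = l by apply: cvg_lim cl; exact: norm_hausdorff.
have c1 : h^-1 *: ((c (h *: (1 : R) + t)).2 - (c t).2) @[h --> 0^'] --> l.2.
  have := cvg_comp _ _ cl (_ : snd @ nbhs l --> nbhs l.2); apply.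
  by case: (l) => x y; exact: (@cvg_snd _ _ (nbhs x) (nbhs y)).
split; first by apply/cvg_ex; exists l.2.
by rewrite lE; apply: cvg_lim c1; exact: norm_hausdorff.
Qed.

Lemma derive1_per c t : (forall s, c (s + 1) = c s) ->
  derive1 c (t + 1) = derive1 c t.
Proof.
move=> cp; rewrite /derive1.
have -> // : (fun h => h^-1 *: (c (h + (t + 1)) - c (t + 1))) =
    (fun h => h^-1 *: (c (h + t) - c t)).
by apply/funext => h; rewrite addrA !cp.
Qed.

Lemma derive1_shift c b t :
  derive1 (fun s => c (b + s)) t = derive1 c (b + t).
Proof.
rewrite /derive1.
have -> // : (fun h => h^-1 *: (c (b + (h + t)) - c (b + t))) =
    (fun h => h^-1 *: (c (h + (b + t)) - c (b + t))).
by apply/funext => h; rewrite addrCA.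
Qed.

Lemma derivable_shift c b t :
  derivable c (b + t) 1 -> derivable (fun s => c (b + s)) t 1.
Proof.
rewrite /derivable.
have -> // : (fun h : R => h^-1 *: (c (b + (h *: (1 : R) + t)) - c (b + t))) =
    (fun h => h^-1 *: (c (h *: (1 : R) + (b + t)) - c (b + t))).
by apply/funext => h; rewrite addrCA.
Qed.

Lemma same_param_near s t : same_param s t -> - 1 < s - t < 1 -> s = t.
Proof.
move=> /Num.Theory.intrP[n nE] /andP[]; rewrite nE => n1 n2.
have {n1} : -1 < n by rewrite -(ltr_int R) mulrNz.
have {n2} : n < 1 by rewrite -(ltr_int R).
by move=> n1 n2; apply/eqP; rewrite -subr_eq0 nE; case: n {nE} n1 n2 => [[|k]|[|k]].
Qed.

(** Extends the homotopy constantly beyond [0, 1], so that estimates near a time need no one-sided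
    version at the ends. *)
Definition clamp u : R := Num.max 0 (Num.min 1 u).

Lemma clamp_itv u : clamp u \in `[0, 1].
Proof. by rewrite in_itv /= /clamp le_max lexx /= ge_max ler01 ge_min lexx. Qed.

Lemma clampE u : 0 <= u <= 1 -> clamp u = u.
Proof. by move=> /andP[u0 u1]; rewrite /clamp min_r // max_r. Qed.

Lemma clamp_lip u u' : `|clamp u - clamp u'| <= `|u - u'|.
Proof.
have cl (x : R) : [\/ x <= 0 /\ clamp x = 0, 1 <= x /\ clamp x = 1 |
    0 <= x <= 1 /\ clamp x = x].
  have [x0|/ltW x0] := leP x 0; first by apply: Or31; rewrite /clamp min_r ?max_l //; lra.
  have [x1|/ltW x1] := leP 1 x; first by apply: Or32; rewrite /clamp min_l ?max_r.
  by apply: Or33; rewrite clampE x0.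
rewrite ler_norml; have [ux|xu] := leP 0 (u - u').
  by rewrite (ger0_norm ux); case: (cl u) => -[? ->]; case: (cl u') => -[? ->]; lra.
by rewrite (ltr0_norm xu); case: (cl u) => -[? ->]; case: (cl u') => -[? ->]; lra.
Qed.

Lemma within_cont2 (F : R * R -> R * R) (z0 : R * R) (e : R) :
  {within [set z : R * R | z.1 \in `[0, 1]], continuous F} ->
  z0.1 \in `[0, 1] -> 0 < e -> exists d : R, 0 < d /\
  forall z, z.1 \in `[0, 1] -> `|z - z0| < d -> `|F z - F z0| < e.
Proof.
move=> /subspace_continuousP/(_ z0) H z01 e0.
have /cvgrPdist_lt/(_ e e0) := H z01.
rewrite /within /= => /nbhs_ballP[d /= d0 Hd].
exists d; split => // z zI zz0; rewrite distrC; apply: Hd => //.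
by rewrite -ball_normE /= distrC.
Qed.

Lemma within_cont1 (b : R -> R) u0 (e : R) :
  {within `[0, 1], continuous b} -> u0 \in `[0, 1] -> 0 < e ->
  exists d : R, 0 < d /\ forall u, u \in `[0, 1] -> `|u - u0| < d -> `|b u - b u0| < e.
Proof.
move=> /subspace_continuousP/(_ u0) H u0I e0.
have /cvgrPdist_lt/(_ e e0) := H u0I.
rewrite /within /= => /nbhs_ballP[d /= d0 Hd].
exists d; split => // u uI uu; rewrite distrC; apply: Hd => //.
by rewrite -ball_normE /= distrC.
Qed.

Variables (H : R -> R -> R * R) (b : R -> R).
Hypothesis hH : regular_homotopy H.
Hypothesis hb : {within `[0, 1], continuous b}.
Hypothesis hbD : forall u, u \in `[0, 1] -> ~ double_points (H u) (H u (b u)).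

Definition based u t : R * R := H (clamp u) (b (clamp u) + t).
Definition dbased u t : R * R := derive1 (H (clamp u)) (b (clamp u) + t).

Lemma base_cont u0 (e : R) : 0 < e -> exists d : R, 0 < d /\
  forall u, `|u - u0| < d -> `|b (clamp u) - b (clamp u0)| < e.
Proof.
move=> e0; have [d [d0 Hd]] := within_cont1 hb (clamp_itv u0) e0.
exists d; split => // u hu; apply: Hd; first exact: clamp_itv.
exact: le_lt_trans (clamp_lip _ _) hu.
Qed.

Lemma based_cont (F : R -> R -> R * R) :
  {within [set z : R * R | z.1 \in `[0, 1]], continuous (fun z : R * R => F z.1 z.2)} ->
  jointly_continuous (fun u t => F (clamp u) (b (clamp u) + t)).
Proof.
move=> cF u0 t0 e e0.
have [d [d0 Hd]] := @within_cont2 (fun z => F z.1 z.2)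
  (clamp u0, b (clamp u0) + t0) e cF (clamp_itv u0) e0.
have [|d1 [d10 Hd1]] := @base_cont u0 (d / 2); first by rewrite divr_gt0.
exists (Num.min (d / 2) (Num.min d1 d)); split; first by rewrite !lt_min d10 d0 divr_gt0.
move=> u t; rewrite !lt_min => /and3P[_ hu1 hu2] /and3P[ht _ _].
apply: (Hd (clamp u, b (clamp u) + t)); first exact: clamp_itv.
rewrite pair_norm_lt /= (le_lt_trans (clamp_lip _ _) hu2) /=.
rewrite opprD addrACA (le_lt_trans (ler_normD _ _)) // [ltRHS]splitr ltrD //.
exact: Hd1.
Qed.

Lemma based_family : curve_family based dbased.
Proof.
have [hG hc hd] := hH.
have gen u : generic_closed_curve (H (clamp u)) by exact: hG (clamp_itv u).
split.
- exact: based_cont hc.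
- exact: (@based_cont (fun u => derive1 (H u)) hd).
- move=> u t; have [sm _ _ _ _] := gen u; rewrite /dbased -derive1_shift.
  exact: is_derive_fst (derivable_shift (sm 0%N _)).
- move=> u t; have [sm _ _ _ _] := gen u; rewrite /dbased -derive1_shift.
  exact: is_derive_snd (derivable_shift (sm 0%N _)).
- by move=> u t; have [_ per _ _ _] := gen u; rewrite /based addrA per.
- by move=> u t; have [_ _ imm _ _] := gen u; exact: imm.
- move=> u s t s0 st t1 E; have [_ _ _ tr _] := gen u; apply: tr => //.
  move/same_param_near; rewrite opprD addrACA subrr add0r => E'.
  suff : b (clamp u) + s = b (clamp u) + t by lra.
  by apply: E'; lra.
- move=> u t /andP[t0 t1]; apply/eqP => E; apply: (hbD (clamp_itv u)).
  exists (b (clamp u)), (b (clamp u) + t); split=> //.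
    move/same_param_near; rewrite opprD addrA subrr add0r => E'.
    suff : b (clamp u) = b (clamp u) + t by lra.
    by apply: E'; lra.
  by move: E; rewrite /based addr0.
Qed.
End FromHomotopy.

(** * The winding number on components of the complement *)

Section Components.
Variable R : realType.
Implicit Types (u s t : R) (x y z : R * R).
Variables (a da : R -> R -> R * R) (fam : curve_family a da).

(** By [wn_stable] the points off the curve with a prescribed winding number form an open set, and
    so do those with any other value; a connected set off the curve meets only one of the two. *)
Lemma wn_component u x y : component_of (a u) x y ->
  (forall t, a u t != y) /\ wn (fun t => a u t - y) = wn (fun t => a u t - x).
Proof.
move=> [C [Cx CA Cconn] Cy].
have off z : C z -> forall t, a u t != z.
  by move=> Cz t; apply/eqP => E; apply: (CA z Cz); exists t.
split; first exact: off.
pose P (n : int -> Prop) : set (R * R) :=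
  [set z | (forall t, a u t != z) /\ n (wn (fun t => a u t - z))].
have oP n : open (P n).
  rewrite openE => z [z_off nz]; have [d [d0 Hd]] := wn_stable fam z_off.
  apply/nbhs_ballP; exists d => //= z'; rewrite -ball_normE /= distrC => zz'.
  by have [|h1 h2] := Hd u z' _ zz'; rewrite ?subrr ?normr0 //; split; rewrite ?h2.
pose w := wn (fun t => a u t - x).
have /(_ (C `&` P (fun n => n = w)))E := Cconn.
suff : (C `&` P (fun n => n = w)) y by case=> _ [].
rewrite E //.
- by exists x; split => //; split => //; exact: off.
- by exists (P (fun n => n = w)).
exists (~` P (fun n => n <> w)); first exact: open_closedC.
apply/seteqP; split => z [Cz].
  by move=> [z_off zw]; split => // -[_]; apply.
move=> nPz; split => //; split; first exact: off.
by apply: contrapT => zw; apply: nPz; split => //; exact: off.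
Qed.

(** The point is moved far away inside its component; from there the curve is seen within a half
    plane, like a constant loop. *)
Lemma wn_unbounded u x : (forall t, a u t != x) ->
  ~ bounded_set (component_of (a u) x) -> wn (fun t => a u t - x) = 0.
Proof.
move=> x_off unb.
have [M [M0 HM]] : exists M : R, 0 <= M /\ forall t, `|a u t| <= M.
  have [|m mI Hm] := @EVT_max R (fun t => `|a u t|) 0 1 ler01.
    apply: continuous_in_subspaceT => t _.
    by apply: continuous_comp; [exact: (fam_continuous fam)|exact: norm_continuous].
  exists `|a u m|; split => // t; have [t' [t'I ->]] := fam_reduce fam 0 t.
  by apply: Hm; rewrite in_itv /=; lra.
(* The factor 2 is due to the sup norm: against the square of the larger coordinate [q] of [y] there
   are two error terms, each at most |q| M. *)
have [y [Cy yM]] : exists y, component_of (a u) x y /\ 2 * M < `|y|.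
  apply: contrapT => H; apply: unb; exists (2 * M); split; first exact: num_real.
  move=> r rM y Cy; rewrite /= leNgt; apply/negP => ry; apply: H; exists y.
  by split => //; exact: lt_trans ry.
have [y_off <-] := wn_component Cy.
have y0 : y != 0 by rewrite -normr_gt0; lra.
have ly : loop (fun=> - y).
  by split => [t|//|t]; [exact: cvg_cst|rewrite oppr_eq0].
have -> : wn (fun t => a u t - y) = wn (fun=> - y).
  apply: wn_dot => //; first exact: (fam_loop fam).
  move=> t; have := HM t; move: yM; rewrite !prod_normE.
  case: y {Cy y_off y0 ly} (a u t) => y1 y2 [a1 a2] /=; rewrite /dot2 /= => yM.
  rewrite ge_max => /andP[]; rewrite !ler_norml => /andP[? ?] /andP[? ?].
  have key (p q r1 r2 : R) : `|p| <= `|q| -> 2 * M < `|q| -> - M <= r1 <= M ->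
      - M <= r2 <= M -> 0 < (r1 - p) * - p + (r2 - q) * - q.
    move=> pq qM r1M r2M.
    have e1 : p * r1 <= `|q| * M.
      rewrite (le_trans (ler_norm _)) // normrM ler_pM ?normr_ge0 // ler_norml; lra.
    have e2 : q * r2 <= `|q| * M.
      rewrite (le_trans (ler_norm _)) // normrM ler_pM ?normr_ge0 // ler_norml; lra.
    have e3 : `|q| * (2 * M) < `|q| * `|q| by rewrite ltr_pM2l //; lra.
    have e4 : `|q| * `|q| = q * q by rewrite -normrM ger0_norm // -expr2 sqr_ge0.
    have e5 : 0 <= p * p by rewrite -expr2 sqr_ge0.
    lra.
  have [y12|y21] := leP `|y1| `|y2|.
    by apply: key => //; [rewrite max_r in yM|lra|lra].
  rewrite addrC; apply: key => //; [exact: ltW|by rewrite max_l ?ltW in yM|lra|lra].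
have [_ _ ny] := ly; have [p hp] := has_arg_ex (ny 0).
have := @loop_wn R (fun=> - y) (fun=> p) ly; rewrite subrr => H.
apply: (@intr2pi_inj R); rewrite -H ?mulr0 //.
by split => // t; exact: cvg_cst.
Qed.

End Components.

(** * Double points and signs of one generic curve *)

Section SingleCurve.
Variable R : realType.
Implicit Types (u s t : R) (x y z : R * R).
Variables (c : R -> R * R) (b0 : R) (a : R -> R -> R * R) (u : R).
Hypothesis gen : generic_closed_curve c.
Hypothesis base : ~ double_points c (c b0).
Hypothesis aE : forall t, a u t = c (b0 + t).

Lemma not_same_param s t : s != t -> - 1 < s - t < 1 ->
  ~ same_param (b0 + s) (b0 + t).
Proof.
move=> /eqP st h /same_param_near E; apply: st.
suff : b0 + s = b0 + t by lra.
by apply: E; rewrite opprD addrACA subrr add0r.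
Qed.

Lemma dpair_third z t : dpair a u z -> 0 < t < 1 -> a u t = a u z.1 ->
  t = z.1 \/ t = z.2.
Proof.
move=> [z0 z12 z1 E] tI Et; have [_ _ _ _ triple] := gen.
have [tz1|tz1] := eqVneq t z.1; first by left.
have [tz2|tz2] := eqVneq t z.2; first by right.
exfalso; apply: (triple (b0 + t) (b0 + z.1) (b0 + z.2)).
- by apply: not_same_param => //; lra.
- by apply: not_same_param; [rewrite lt_eqF|lra].
- by apply: not_same_param => //; lra.
- by rewrite -!aE.
Qed.

Lemma dpair_inj z z' : dpair a u z -> dpair a u z' -> a u z.1 = a u z'.1 -> z = z'.
Proof.
move=> zu z'u E; have [z0 z12 z1 Ez] := zu; have [z0' z12' z1' Ez'] := z'u.
have h1 : z'.1 = z.1 \/ z'.1 = z.2 by apply: dpair_third => //; lra.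
have h2 : z'.2 = z.1 \/ z'.2 = z.2.
  by apply: dpair_third => //; [lra|rewrite -Ez'].
rewrite [z]surjective_pairing [z']surjective_pairing.
move: z12 z12' {E Ez Ez' zu z'u}; move: h1 h2 => [->|->] [->|->] // h1 h2.
- by rewrite ltxx in h2.
- by have := lt_trans h1 h2; rewrite ltxx.
- by rewrite ltxx in h2.
Qed.

(** Injectivity is the absence of triple points; surjectivity reduces both parameters to the period
    starting at [b0]. *)
Lemma dpair_points :
  set_bij (dpair a u) (double_points c) (fun z => a u z.1).
Proof.
have [_ per _ _ _] := gen.
split.
- move=> z [z0 z12 z1 E]; exists (b0 + z.1), (b0 + z.2); split; rewrite -?aE //.
  by apply: not_same_param; [rewrite lt_eqF|lra].
- by move=> z z' /set_mem zu /set_mem z'u; exact: dpair_inj.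
have red t : exists t', [/\ 0 <= t' < 1, c t = a u t' & same_param t (b0 + t')].
  pose n := Num.floor (t - b0); exists (t - b0 - n%:~R); split.
  - by have := Num.Theory.floor_itv (t - b0); rewrite -/n intrD; lra.
  - by rewrite aE -(periodicz t (- n) per) mulrNz; congr c; ring.
  - rewrite /same_param; apply/Num.Theory.intrP; exists n; ring.
move=> x [s [t [st sx tx]]].
have [s' [s'I Es ss']] := red s; have [t' [t'I Et tt']] := red t.
(* A parameter of a double point cannot reduce to 0, the base point not being double. *)
have nz r r' q : ~ same_param r q -> c r = x -> c q = x -> c r = a u r' ->
    same_param r (b0 + r') -> 0 <= r' < 1 -> 0 < r'.
  move=> rq rx qx Er rr' r'I; rewrite lt_neqAle (andP r'I).1 andbT eq_sym.
  apply/eqP => r'0; apply: base; exists r, q; split => //.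
    by rewrite Er r'0 aE addr0.
  by rewrite qx -rx Er r'0 aE addr0.
have s'0 : 0 < s' by exact: nz st sx tx Es ss' s'I.
have t'0 : 0 < t'.
  by apply: nz tx sx Et tt' t'I => H; apply: st; rewrite /same_param -opprB rpredN.
have E : a u s' = a u t' by rewrite -Es -Et sx tx.
have [s't'|t's'|s't'] := ltgtP s' t'.
- by exists (s', t'); [split => //=; lra|rewrite /= -Es].
- by exists (t', s'); [split => //=; lra|rewrite /= -Et].
exfalso; apply: st; rewrite /same_param.
have -> : s - t = (s - (b0 + s')) - (t - (b0 + t')) by rewrite s't'; ring.
exact: rpredB.
Qed.

(** Any admissible [t0] differs from [b0] by an integer because the base point is not double; by
    [dpair_inj] the two other parameters are then [z] shifted accordingly, so all choices give the
    same sign. *)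
Lemma e_sign_dpair z : dpair a u z -> e_sign c (c b0) (a u z.1) =
  sgz (det2 (derive1 c (b0 + z.1)) (derive1 c (b0 + z.2))).
Proof.
have [_ per _ _ _] := gen.
move=> zu; have [z0 z12 z1 Ez] := zu.
apply: xget_subset1.
  exists b0, (b0 + z.1), (b0 + z.2); split => //; first by split; lra.
  by rewrite -aE Ez aE.
move=> e e' [t0 [t1 [t2 [tI E0 E1 E2 ->]]]].
suff H s0 s1 s2 : [/\ s0 < s1, s1 < s2 & s2 < 1 + s0] -> c s0 = c b0 ->
    c s1 = a u z.1 -> c s2 = a u z.1 ->
    sgz (det2 (derive1 c s1) (derive1 c s2)) =
    sgz (det2 (derive1 c (b0 + z.1)) (derive1 c (b0 + z.2))).
  move=> [s0 [s1 [s2 [sI S0 S1 S2 E']]]].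
  apply: (etrans (H _ _ _ tI E0 E1 E2)).
  by rewrite E'; exact: (esym (H _ _ _ sI S0 S1 S2)).
move=> [s01 s12 s20] S0 S1 S2.
have /Num.Theory.intrP[n nE] : same_param s0 b0.
  by apply: contrapT => H; apply: base; exists s0, b0; split.
have dper s (m : int) : derive1 c (s + m%:~R) = derive1 c s.
  by apply: periodicz => t; exact: derive1_per.
have sE s : s = b0 + (s - s0) + n%:~R by rewrite -nE; ring.
have cE s : c s = a u (s - s0) by rewrite aE {1}(sE s) periodicz.
have zE : (s1 - s0, s2 - s0) = z.
  apply: dpair_inj => //; last by rewrite /= -cE.
  by split=> /=; [lra|lra|lra|rewrite -!cE S1 S2].
by rewrite {1}(sE s1) {1}(sE s2) !dper -zE.
Qed.
End SingleCurve.

(** * From triple points of the pair of curves to jumps of F *)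

Section Visits.
Variable R : realType.
Implicit Types (u s t : R) (x z : R * R).

Definition edge0 : 'I_3 := @Ordinal 3 0 isT.
Definition edge1 : 'I_3 := @Ordinal 3 1 isT.
Definition edge2 : 'I_3 := @Ordinal 3 2 isT.

Lemma edgeP (i : 'I_3) : [\/ i = edge0, i = edge1 | i = edge2].
Proof.
case: i => -[|[|[|//]]] h; [apply: Or31|apply: Or32|apply: Or33]; exact: val_inj.
Qed.

Lemma edgeD : [/\ edge0 + 1 = edge1, edge1 + 1 = edge2 & edge2 + 1 = edge0].
Proof. by split; apply: val_inj. Qed.

(** The factors -1 come from the edges outside [A], whose number is 3 minus that of [A]; the oddness
    of 3 is the extra minus sign. *)
Lemma edge_sign (A : {set 'I_3}) (f : 'I_3 -> int) :
  (forall i, f i = if i \in A then 1 else -1) ->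
  f edge0 * f edge1 * f edge2 = - (-1) ^+ #|A|.
Proof.
move=> fE; have -> : #|A| = ((edge0 \in A) + (edge1 \in A) + (edge2 \in A))%N.
  rewrite -sum1_card big_mkcond /= !big_ord_recl big_ord0 addn0 addnA.
  have -> : lift ord0 (lift ord0 ord0) = edge2 by apply: val_inj.
  have -> : lift ord0 ord0 = edge1 by apply: val_inj.
  have -> : ord0 = edge0 by apply: val_inj.
  by do 3!case: (_ \in A).
by rewrite !fE; do 3!case: (_ \in A).
Qed.

Definition visits (p0 p1 p2 : bool * R) (i : 'I_3) : bool * R :=
  match val i with 0 => p0 | 1 => p1 | _ => p2 end.

Lemma visit_lt_trans (p q r : bool * R) :
  visit_lt p q -> visit_lt q r -> visit_lt p r.
Proof.
case: p q r => [i x] [j y] [k z]; rewrite /visit_lt /=.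
move=> [[-> ->]|[-> xy]] [[h ->]|[<- yz]]; try discriminate h; try by left.
by right; split => //; exact: lt_trans yz.
Qed.

Lemma visits_triple (c : bool -> R -> R * R) (b : bool -> R) (p0 p1 p2 : bool * R) :
  b p0.1 <= p0.2 < b p0.1 + 1 -> b p1.1 <= p1.2 < b p1.1 + 1 ->
  b p2.1 <= p2.2 < b p2.1 + 1 -> visit_lt p0 p1 -> visit_lt p1 p2 ->
  c p0.1 p0.2 = c p1.1 p1.2 -> c p1.1 p1.2 = c p2.1 p2.2 -> p0.1 != p2.1 ->
  triple_point c b (visits p0 p1 p2).
Proof.
move=> h0 h1 h2 l01 l12 E01 E12 ne; split; last by exists edge0, edge2.
- by move=> i; case: (edgeP i) => ->.
- move=> i j; case: (edgeP i) => ->; case: (edgeP j) => -> //= _.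
  exact: visit_lt_trans l01 l12.
- have H i : c (visits p0 p1 p2 i).1 (visits p0 p1 p2 i).2 = c p0.1 p0.2.
    by case: (edgeP i) => ->; rewrite /visits /= ?E01 ?E12.
  by move=> i j; rewrite !H.
Qed.

(** Visits of curve 0 precede those of curve 1 and both occur, so only the middle visit is left
    open; it decides whose double point is involved. *)
Lemma triple_point_curves (c : bool -> R -> R * R) (b : bool -> R) v :
  triple_point c b v -> (v edge0).1 = false /\ (v edge2).1 = true.
Proof.
move=> [_ lt _ [i [j]]].
have := lt edge0 edge1 isT; have := lt edge1 edge2 isT; rewrite /visit_lt.
have H k : v k = v edge0 \/ v k = v edge1 \/ v k = v edge2.
  by case: (edgeP k) => ->; [left|right; left|right; right].
move=> [[h1 h2]|[h1 _]] [[h3 h4]|[h3 _]].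
- by rewrite h1 in h4.
- by rewrite h2 h3 h1.
- by rewrite -h1 h3 h4.
have E k : (v k).1 = (v edge0).1.
  by case: (H k) => [->//|[->|->]]; rewrite -?h1 -h3.
by rewrite !E eqxx.
Qed.

Variables (H : R -> R -> R * R) (b : R -> R) (c1 : R -> R * R) (b1 : R).
Hypothesis hH : regular_homotopy H.
Hypothesis hb : {within `[0, 1], continuous b}.
Hypothesis hbD : forall u, u \in `[0, 1] -> ~ double_points (H u) (H u (b u)).
Hypothesis gen1 : generic_closed_curve c1.
Hypothesis base1 : ~ double_points c1 (c1 b1).

Lemma smooth_continuous (c : R -> R * R) : smooth_curve c -> continuous c.
Proof.
move=> sm t; apply: differentiable_continuous; apply/derivable1_diffP.
exact: (sm 0%N).
Qed.

Lemma regular_homotopy_cst : regular_homotopy (fun=> c1).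
Proof.
have [sm _ _ _ _] := gen1.
have wc (f : R -> R * R) : continuous f ->
    {within [set z : R * R | z.1 \in `[0, 1]], continuous (fun z : R * R => f z.2)}.
  move=> cf; apply: continuous_in_subspaceT => -[x y] _.
  apply: continuous_comp; last exact: cf.
  exact: (@cvg_snd _ _ (nbhs x) (nbhs y)).
split => //; apply: wc; first exact: smooth_continuous.
by move=> t; apply: differentiable_continuous; apply/derivable1_diffP; exact: (sm 1%N).
Qed.

Let cb1 (u : R) : R := b1.

Lemma cb1_continuous : {within `[0, 1], continuous cb1}.
Proof. by apply: continuous_in_subspaceT => t _; exact: cvg_cst. Qed.

Definition fa0 := based_family hH hb hbD.
Definition fa1 := based_family regular_homotopy_cst cb1_continuous (fun _ _ => base1).

Let A0 := based H b.
Let dA0 := dbased H b.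
Let A1 := based (fun=> c1) cb1.
Let dA1 := dbased (fun=> c1) cb1.

(** The function F(u) of the overview, in terms of parameter pairs. *)
Definition crossing_sum u : int := dsum A0 dA0 A1 u + dsum A1 dA1 A0 u.

Lemma A0E u t : u \in `[0, 1] -> A0 u t = H u (b u + t).
Proof. by rewrite in_itv /= => uI; rewrite /A0 /based clampE. Qed.

Lemma dA0E u t : u \in `[0, 1] -> dA0 u t = derive1 (H u) (b u + t).
Proof. by rewrite in_itv /= => uI; rewrite /dA0 /dbased clampE. Qed.

(** Puts a double point lying on the other curve into the format of [triple_point], so that absence
    or uniqueness of triple points controls the pairs; [t] is reduced to the period that starts at
    [b1]. *)
Lemma crossing_visits0 u z t : u \in `[0, 1] -> dpair A0 u z ->
  A1 u t = A0 u z.1 -> exists t', same_param t' (b1 + t) /\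
    triple_point (moving H c1 u) (moving_base b b1 u)
      (visits (false, b u + z.1) (false, b u + z.2) (true, t')).
Proof.
move=> uI [z0 z12 z1 Ez] Et; have [_ per _ _ _] := gen1.
pose n := Num.floor t; exists (b1 + t - n%:~R); split.
  by apply/Num.Theory.intrP; exists (- n); rewrite mulrNz; ring.
have := Num.Theory.floor_itv t; rewrite -/n intrD => nI.
apply: visits_triple => //=; rewrite /moving /moving_base /two /=.
- by lra.
- by lra.
- by lra.
- by right; split => //=; lra.
- by left.
- by rewrite -!A0E.
- by rewrite -A0E // -Ez -Et /A1 /based -[RHS](periodicz _ n per) subrK.
Qed.

Lemma crossing_visits1 u z t : u \in `[0, 1] -> dpair A1 u z ->
  A0 u t = A1 u z.1 -> exists t', same_param t' (b u + t) /\
    triple_point (moving H c1 u) (moving_base b b1 u)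
      (visits (false, t') (true, b1 + z.1) (true, b1 + z.2)).
Proof.
move=> uI [z0 z12 z1 Ez] Et; have [gen _ _] := hH; have [_ per _ _ _] := gen u uI.
pose n := Num.floor t; exists (b u + t - n%:~R); split.
  by apply/Num.Theory.intrP; exists (- n); rewrite mulrNz; ring.
have := Num.Theory.floor_itv t; rewrite -/n intrD => nI.
apply: visits_triple => //=; rewrite /moving /moving_base /two /=.
- by lra.
- by lra.
- by lra.
- by left.
- by right; split => //=; lra.
- rewrite -[RHS]/(A1 u z.1) -Et A0E //.
  by rewrite -[LHS](periodicz _ n per) subrK.
Qed.

Lemma crossing_sum_stable u0 : u0 \in `[0, 1] ->
  (forall v, ~ triple_point (moving H c1 u0) (moving_base b b1 u0) v) ->
  exists d : R, 0 < d /\ forall u, `|u - u0| < d -> crossing_sum u = crossing_sum u0.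
Proof.
move=> uI none.
have [|d [d0 Hd]] := dsum_stable fa0 fa1 (u0 := u0).
  by move=> z t zu; apply/eqP => /(crossing_visits0 uI zu)[t' [_ /none]].
have [|d' [d'0 Hd']] := dsum_stable fa1 fa0 (u0 := u0).
  by move=> z t zu; apply/eqP => /(crossing_visits1 uI zu)[t' [_ /none]].
exists (Num.min d d'); split; first by rewrite lt_min d0.
by move=> u; rewrite lt_min => /andP[h h']; congr (_ + _); [exact: Hd|exact: Hd'].
Qed.

Lemma near_left (P : R -> Prop) u0 : (\forall u \near u0^'-, P u) ->
  exists d : R, 0 < d /\ forall u, u0 - d < u < u0 -> P u.
Proof.
rewrite near_withinE => /nbhs_ballP[d /= d0 Hd]; exists d; split => // u /andP[h1 h2].
by apply: Hd => //; rewrite -ball_normE /= ltr_norml; lra.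
Qed.

Lemma near_right (P : R -> Prop) u0 : (\forall u \near u0^'+, P u) ->
  exists d : R, 0 < d /\ forall u, u0 < u < u0 + d -> P u.
Proof.
rewrite near_withinE => /nbhs_ballP[d /= d0 Hd]; exists d; split => // u /andP[h1 h2].
by apply: Hd => //; rewrite -ball_normE /= ltr_norml; lra.
Qed.

Lemma agreeing_sgz (A : {set 'I_3}) (x y : 'I_3 -> R) :
  agreeing_edges x y = A -> (forall i, x i != y i) ->
  forall i, sgz (y i - x i) = if i \in A then 1 else -1.
Proof.
move=> <- xy i; rewrite inE; move: (xy i); case: ltgtP => // h _.
  by rewrite gtr0_sgz // subr_gt0.
by rewrite ltr0_sgz // subr_lt0.
Qed.

Lemma ltD_shift (x v p p0 e : R) : `|x - v| < e / 2 -> `|p - p0| < e / 2 ->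
  `|(x - p) - (v - p0)| < e.
Proof.
move=> h1 h2; have -> : (x - p) - (v - p0) = (x - v) - (p - p0) by ring.
by rewrite (le_lt_trans (ler_normB _ _)) // [ltRHS]splitr ltrD.
Qed.

(** The sum over the curve visited twice jumps by [dsum_jump]. The other sum is locally constant,
    since a double point of the other curve in such a position would be a second triple point. *)
Lemma crossing_sum_jump u0 v A : 0 < u0 < 1 ->
  triple_point (moving H c1 u0) (moving_base b b1 u0) v ->
  (forall w, triple_point (moving H c1 u0) (moving_base b b1 u0) w -> w = v) ->
  transverse_branches (moving H c1 u0) v ->
  triple_crossing (moving H c1) u0 v A ->
  exists d : R, 0 < d /\ forall u u', u0 - d < u < u0 -> u0 < u' < u0 + d ->
    crossing_sum u' - crossing_sum u = - (-1) ^+ #|A|.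
Proof.
move=> u01 tv uniq_v trans cross.
have uI : u0 \in `[0, 1] by rewrite in_itv /=; lra.
have [D01 D12 D20] := edgeD.
have [v0F v2T] := triple_point_curves tv.
have [rng ord pts _] := tv.
have [m [m0 mu0 mu1]] : exists m : R, [/\ 0 < m, m <= u0 & m <= 1 - u0].
  by case: (leP u0 (1 - u0)) => ?; [exists u0|exists (1 - u0)]; split; lra.
have itv_near u : `|u - u0| < m -> u \in `[0, 1].
  by rewrite in_itv /= ltr_norml => /andP[? ?]; apply/andP; split; lra.
have bcont (e : R) : 0 < e -> exists d : R, [/\ 0 < d, d <= m &
    forall u, `|u - u0| < d -> `|b u - b u0| < e].
  move=> ep0; have [d [d0 Hd]] := within_cont1 hb uI ep0.
  exists (Num.min d m); rewrite lt_min d0 !ge_min !lexx orbT; split => // u.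
  by rewrite lt_min => /andP[h1 h2]; apply: Hd => //; exact: itv_near.
have zero_lt (e : R) : 0 < e -> `|b1 - b1| < e / 2 by move=> ep0; rewrite subrr normr0 divr_gt0.
have rng0 : b u0 <= (v edge0).2 < b u0 + 1 by have := rng edge0; rewrite v0F.
have rng2 : b1 <= (v edge2).2 < b1 + 1 by have := rng edge2; rewrite v2T.
(* What both cases share: triangles before and after, with opposite orientations. Since parameters
   are counted from the moving base point, half of [e] is reserved for the drift of [b u]. *)
have pack (P : R -> R -> Prop) (e d1 : R) : 0 < e -> 0 < d1 ->
    (forall (u u' : R) (x y x' y' : 'I_3 -> R), `|u - u0| < e -> `|u' - u0| < e ->
       `|u - u0| < d1 -> `|u' - u0| < d1 ->
       u \in `[0, 1] -> u' \in `[0, 1] ->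
       `|b u - b u0| < e / 2 -> `|b u' - b u0| < e / 2 ->
       triangle (e / 2) (moving H c1 u) v x y ->
       triangle (e / 2) (moving H c1 u') v x' y' ->
       (forall i, (x i < y i) = ~~ (x' i < y' i)) ->
       (forall i, sgz (y' i - x' i) = if i \in A then 1 else -1) -> P u u') ->
    exists d : R, 0 < d /\ forall u u', u0 - d < u < u0 -> u0 < u' < u0 + d -> P u u'.
  move=> ep0 d10 HP; have ep2 : 0 < e / 2 by rewrite divr_gt0.
  have [/near_left[dl [dl0 Hl]] /near_right[dr [dr0 Hr]]] := cross _ ep2.
  have [db [db0 dbm Hb]] := bcont _ ep2.
  exists (Num.min (Num.min e d1) (Num.min db (Num.min dl dr))).
  split; first by rewrite !lt_min ep0 d10 db0 dl0.
  set d := Num.min _ _.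
  have : (d <= e) && (d <= d1) && [&& d <= db, d <= dl & d <= dr].
    by rewrite /d !ge_min !lexx !orbT.
  clearbody d => /andP[/andP[de dd1] /and3P[ddb ddl ddr]] u u' /andP[h1 h2] /andP[h3 h4].
  have [|x [y [T E]]] := Hl u; first by rewrite h2 andbT; lra.
  have [|x' [y' [T' E']]] := Hr u'; first by rewrite h3 /=; lra.
  have hu : `|u - u0| < d by rewrite ltr_norml; lra.
  have hu' : `|u' - u0| < d by rewrite ltr_norml; lra.
  have le_d (k : R) w : `|w - u0| < d -> d <= k -> `|w - u0| < k.
    by move=> wd dk; exact: lt_le_trans wd dk.
  apply: (HP u u' x y x' y') => //; rewrite ?(le_d _ _ hu) ?(le_d _ _ hu') //.
  - by apply: itv_near; apply: le_d hu _; exact: le_trans dbm.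
  - by apply: itv_near; apply: le_d hu' _; exact: le_trans dbm.
  - by apply: Hb; exact: le_d ddb.
  - by apply: Hb; exact: le_d ddb.
  - move=> i; have /setP/(_ i) := E; have /setP/(_ i) := E'.
    by rewrite !inE => -> ->.
  - by apply: agreeing_sgz => // i; have [] := T' i.
(* Here curve 1 is visited twice; the triangle is read cyclically from edge 1, as edges 1, 2, 0. *)
case v1E : (v edge1).1.
  pose z0 := ((v edge1).2 - b1, (v edge2).2 - b1); pose s := (v edge0).2 - b u0.
  have rng1 : b1 <= (v edge1).2 < b1 + 1 by have := rng edge1; rewrite v1E.
  have lt12 : (v edge1).2 < (v edge2).2.
    by have := ord edge1 edge2 isT; rewrite /visit_lt v1E v2T => -[[]|[]].
  have p01 : H u0 (v edge0).2 = c1 (v edge1).2.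
    by have := pts edge0 edge1; rewrite v0F v1E.
  have p12 : c1 (v edge1).2 = c1 (v edge2).2.
    by have := pts edge1 edge2; rewrite v1E v2T.
  have gt1 : b1 < (v edge1).2.
    rewrite lt_neqAle (andP rng1).1 andbT; apply/eqP => E; apply: base1.
    exists (v edge1).2, (v edge2).2; split; rewrite ?E //.
    move=> /same_param_near E'; suff : (v edge1).2 = (v edge2).2 by lra.
    by apply: E'; lra.
  have z0u : dpair A1 u0 z0.
    split => /=; [lra|lra|lra|].
    by rewrite /A1 /based /cb1 !(addrC b1) !subrK.
  have cs : A0 u0 s = A1 u0 z0.1.
    by rewrite A0E // /A1 /based /cb1 /= !(addrC _ (_ - _)) !subrK.
  have only z t : dpair A1 u0 z -> A0 u0 t = A1 u0 z.1 -> z = z0 /\ same_param t s.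
    move=> zu /(crossing_visits1 uI zu)[t' [tt' /uniq_v E]]; split.
      by rewrite /z0 -E /visits /= [z]surjective_pairing /=; congr pair; ring.
    rewrite /s -E /visits /= /same_param.
    have -> : t - (t' - b u0) = - (t' - (b u0 + t)) by ring.
    by rewrite rpredN.
  have dt : det2 (dA1 u0 z0.2) (dA0 u0 s) != 0.
    rewrite dA0E // /dA1 /dbased /cb1 /= !(addrC _ (_ - _)) !subrK.
    by have := trans edge2 edge0 isT; rewrite v2T v0F.
  have [e [ep J]] := dsum_jump fa1 fa0 z0u cs only dt.
  have [|d1 [d10 S]] := dsum_stable fa0 fa1 (u0 := u0).
    move=> z t zu; apply/eqP => /(crossing_visits0 uI zu)[t' [_ /uniq_v E]].
    by move: v1E; rewrite -E.
  apply: (pack _ e d1) => //.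
  move=> u u' x y x' y' hu hu' hd hd' uI' u'I' hb1 hb2 T T' opp sg.
  rewrite /crossing_sum (S u hd) (S u' hd') opprD addrACA subrr add0r.
  have small (w : R) (X Y : 'I_3 -> R) : w \in `[0, 1] -> `|b w - b u0| < e / 2 ->
      triangle (e / 2) (moving H c1 w) v X Y ->
      small_triangle A1 A0 w z0 s e (X edge1 - b1) (Y edge1 - b1) (X edge2 - b1) (Y edge2 - b1)
        (X edge0 - b w) (Y edge0 - b w).
    move=> wI hbw TT; have [x0 y0 n0 E0] := TT edge0; have [x1 y1 n1 E1] := TT edge1.
    have [x2 y2 n2 E2] := TT edge2.
    split; [split| | |split|split].
    - exact: ltD_shift (zero_lt _ ep).
    - exact: ltD_shift (zero_lt _ ep).
    - exact: ltD_shift (zero_lt _ ep).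
    - exact: ltD_shift (zero_lt _ ep).
    - exact: ltD_shift.
    - exact: ltD_shift.
    - by rewrite (inj_eq (addIr _)).
    - by rewrite (inj_eq (addIr _)).
    - by rewrite (inj_eq (addIr _)).
    - rewrite /A1 /based /cb1 !(addrC b1) !subrK.
      by move: E1; rewrite D12 v1E v2T.
    - rewrite A0E // /A1 /based /cb1 !(addrC _ (_ - _)) !subrK.
      by move: E2; rewrite D20 v2T v0F.
    - rewrite A0E // /A1 /based /cb1 !(addrC _ (_ - _)) !subrK.
      by move: E0; rewrite D01 v0F v1E.
  rewrite (J _ _ hu hu' _ _ _ _ _ _ _ _ _ _ _ _ (small _ _ _ uI' hb1 T)
    (small _ _ _ u'I' hb2 T')); last by rewrite !ltrD2r.
  rewrite -(edge_sign sg) !opprB !addrA !subrK.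
  by rewrite mulrC mulrA.
(* Here the moving curve is visited twice and the edges keep their numbering. *)
pose z0 := ((v edge0).2 - b u0, (v edge1).2 - b u0); pose s := (v edge2).2 - b1.
have rng1 : b u0 <= (v edge1).2 < b u0 + 1 by have := rng edge1; rewrite v1E.
have lt01 : (v edge0).2 < (v edge1).2.
  by have := ord edge0 edge1 isT; rewrite /visit_lt v0F v1E => -[[]|[]].
have p01 : H u0 (v edge0).2 = H u0 (v edge1).2.
  by have := pts edge0 edge1; rewrite v0F v1E.
have p02 : H u0 (v edge0).2 = c1 (v edge2).2.
  by have := pts edge0 edge2; rewrite v0F v2T.
have gt0 : b u0 < (v edge0).2.
  rewrite lt_neqAle (andP rng0).1 andbT; apply/eqP => E; apply: (hbD uI).
  exists (v edge0).2, (v edge1).2; split; rewrite ?E //.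
  move=> /same_param_near E'; suff : (v edge0).2 = (v edge1).2 by lra.
  by apply: E'; lra.
have z0u : dpair A0 u0 z0.
  split => /=; [lra|lra|lra|].
  by rewrite !A0E // !(addrC (b u0)) !subrK.
have cs : A1 u0 s = A0 u0 z0.1.
  by rewrite A0E // /A1 /based /cb1 /= !(addrC _ (_ - _)) !subrK.
have only z t : dpair A0 u0 z -> A1 u0 t = A0 u0 z.1 -> z = z0 /\ same_param t s.
  move=> zu /(crossing_visits0 uI zu)[t' [tt' /uniq_v E]]; split.
    by rewrite /z0 -E /visits /= [z]surjective_pairing /=; congr pair; ring.
  rewrite /s -E /visits /= /same_param.
  have -> : t - (t' - b1) = - (t' - (b1 + t)) by ring.
  by rewrite rpredN.
have dt : det2 (dA0 u0 z0.2) (dA1 u0 s) != 0.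
  rewrite dA0E // /dA1 /dbased /cb1 /= !(addrC _ (_ - _)) !subrK.
  by have := trans edge1 edge2 isT; rewrite v1E v2T.
have [e [ep J]] := dsum_jump fa0 fa1 z0u cs only dt.
have [|d1 [d10 S]] := dsum_stable fa1 fa0 (u0 := u0).
  move=> z t zu; apply/eqP => /(crossing_visits1 uI zu)[t' [_ /uniq_v E]].
  by move: v1E; rewrite -E.
apply: (pack _ e d1) => //.
move=> u u' x y x' y' hu hu' hd hd' uI' u'I' hb1 hb2 T T' opp sg.
rewrite /crossing_sum (S u hd) (S u' hd') opprD addrACA subrr addr0.
have small (w : R) (X Y : 'I_3 -> R) : w \in `[0, 1] -> `|b w - b u0| < e / 2 ->
    triangle (e / 2) (moving H c1 w) v X Y ->
    small_triangle A0 A1 w z0 s e (X edge0 - b w) (Y edge0 - b w) (X edge1 - b w) (Y edge1 - b w)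
      (X edge2 - b1) (Y edge2 - b1).
  move=> wI hbw TT; have [x0 y0 n0 E0] := TT edge0; have [x1 y1 n1 E1] := TT edge1.
  have [x2 y2 n2 E2] := TT edge2.
  split; [split| | |split|split].
  - exact: ltD_shift.
  - exact: ltD_shift.
  - exact: ltD_shift.
  - exact: ltD_shift.
  - exact: ltD_shift (zero_lt _ ep).
  - exact: ltD_shift (zero_lt _ ep).
  - by rewrite (inj_eq (addIr _)).
  - by rewrite (inj_eq (addIr _)).
  - by rewrite (inj_eq (addIr _)).
  - rewrite !A0E // !(addrC _ (_ - _)) !subrK.
    by move: E0; rewrite D01 v0F v1E.
  - rewrite A0E // /A1 /based /cb1 !(addrC _ (_ - _)) !subrK.
    by move: E1; rewrite D12 v1E v2T.
  - rewrite A0E // /A1 /based /cb1 !(addrC _ (_ - _)) !subrK.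
    by move: E2; rewrite D20 v2T v0F.
rewrite (J _ _ hu hu' _ _ _ _ _ _ _ _ _ _ _ _ (small _ _ _ uI' hb1 T)
  (small _ _ _ u'I' hb2 T')); last by rewrite !ltrD2r.
by rewrite -(edge_sign sg) !opprB !addrA !subrK.
Qed.
End Visits.

(** * Total variation of a function with finitely many jumps *)

Section JumpSum.
Variable R : realType.
Implicit Types (F N : R -> int) (s : seq R) (a b t u w : R).

Lemma locally_constant_segment F a b : a <= b ->
  (forall t, a <= t <= b -> exists d : R, 0 < d /\
     forall u, a <= u <= b -> `|u - t| < d -> F u = F t) -> F a = F b.
Proof.
move=> ab lc.
have [|d [d0 Hd]] := @segment_uniform R a b (fun e t => a <= t <= b ->
    forall u, a <= u <= b -> `|u - t| < e -> F u = F t).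
  move=> t /lc[d [d0 Hd]]; exists (d / 2); split; first by rewrite divr_gt0.
  move=> t' tt' e /andP[e0 ed] t'I u uI ut'.
  rewrite (Hd t') //; last by apply: lt_trans tt' _; lra.
  apply: Hd => //; rewrite -(subrK t' u) -addrA (le_lt_trans (ler_normD _ _)) //.
  by rewrite [ltRHS]splitr ltrD // (lt_trans ut').
have [h [h0 hd]] : exists h : R, 0 < h /\ h < d / 2 by exists (d / 4); lra.
have step n : a + h * n%:R <= b -> F (a + h * n%:R) = F a.
  elim: n => [_|n IH]; first by rewrite mulr0 addr0.
  rewrite -natr1 mulrDr mulr1 => nb.
  have hn : 0 <= h * n%:R by rewrite mulr_ge0 // ltW.
  rewrite -IH; last lra.
  by apply: (Hd (d / 2)); rewrite ?ltr_norml; lra.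
pose n := Num.trunc ((b - a) / h).
have ba : 0 <= (b - a) / h by rewrite divr_ge0 ?subr_ge0 // ltW.
have n1 : n%:R * h <= b - a by rewrite -ler_pdivlMr // Num.Theory.truncn_le.
have n2 : b - a < n.+1%:R * h by rewrite -ltr_pdivrMr // Num.Theory.truncnS_gt.
have hn : 0 <= h * n%:R by rewrite mulr_ge0 // ltW.
rewrite -(step n); last lra.
rewrite -natr1 in n2.
by apply: (Hd (d / 2)); rewrite ?ltr_norml; lra.
Qed.

(** Induction on the number of jumps: the interval is cut around the first listed jump [w], without
    any sorting, and the parts [a, w - h] and [w + h, b] carry fewer jumps. The value of [F] at [w]
    never enters. *)
Lemma jump_sum F N a b s : a <= b -> uniq s -> (forall w, w \in s -> a < w < b) ->
  (forall t, a <= t <= b -> t \notin s -> exists d : R, 0 < d /\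
     forall u, `|u - t| < d -> F u = F t) ->
  (forall w, w \in s -> exists d : R, 0 < d /\ forall u u',
     w - d < u < w -> w < u' < w + d -> F u' - F u = - N w) ->
  F a = F b + \sum_(w <- s) N w.
Proof.
have [n] := ubnP (size s); elim: n a b s => // n IH a b [|w s] /= sn ab us sI lc jump.
  rewrite big_nil addr0; apply: locally_constant_segment => // t tI.
  by have [//|d [d0 Hd]] := lc t tI; exists d; split => // u _; exact: Hd.
have {}sn : (size s < n)%N by [].
have [wI us'] : w \notin s /\ uniq s by apply/andP.
have [d1 [d10 J]] := jump w (mem_head _ _).
have /andP[aw wb] := sI w (mem_head _ _).
have [|||d2 [d20 far]] := @finite_uniform R R [set` s] (fun x d => d <= `|x - w|).
- exact: finite_seq.
- by move=> x d d' /andP[_ d'd] dx; exact: le_trans dx.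
- move=> x xs; exists `|x - w|; split => //; rewrite normr_gt0 subr_eq0.
  by apply: contraNneq wI => <-.
(* Smaller than the distance from [w] to the other jumps and to the ends, so the remaining jumps are
   strictly inside the two parts. *)
have [h [h0 h1 h2 h3 h4]] : exists h : R,
    [/\ 0 < h, h < d1, h < d2, h < w - a & h < b - w].
  exists (Num.min (Num.min d1 d2) (Num.min (w - a) (b - w)) / 2).
  set m := Num.min _ _.
  have m0 : 0 < m by rewrite !lt_min d10 d20 !subr_gt0 aw.
  have : (m <= d1) && (m <= d2) && ((m <= w - a) && (m <= b - w)).
    by rewrite /m !ge_min !lexx !orbT.
  by clearbody m => /andP[/andP[? ?] /andP[? ?]]; split; lra.
have E1 : F a = F (w - h) + \sum_(x <- s | x < w) N x.
  rewrite -big_filter; apply: IH.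
  - by rewrite (leq_ltn_trans _ sn) // size_filter count_size.
  - lra.
  - exact: filter_uniq.
  - move=> x; rewrite mem_filter => /andP[xw xs].
    have /andP[ax _] := sI x (mem_behead xs (s := w :: s)).
    have := far x xs; rewrite ltr0_norm ?subr_lt0 // ax /=; lra.
  - move=> t tI; rewrite mem_filter negb_and => ts; apply: lc; first lra.
    rewrite inE negb_or; apply/andP; split; first by rewrite lt_eqF //; lra.
    by case/orP: ts => //; rewrite -leNgt => wt; lra.
  - by move=> x; rewrite mem_filter => /andP[_ xs]; apply: jump; rewrite inE xs orbT.
have E2 : F (w + h) = F b + \sum_(x <- s | ~~ (x < w)) N x.
  rewrite -big_filter; apply: IH.
  - by rewrite (leq_ltn_trans _ sn) // size_filter count_size.
  - lra.
  - exact: filter_uniq.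
  - move=> x; rewrite mem_filter -leNgt => /andP[wx xs].
    have /andP[_ xb] := sI x (mem_behead xs (s := w :: s)).
    have := far x xs; rewrite ger0_norm ?subr_ge0 // xb andbT; lra.
  - move=> t tI; rewrite mem_filter negb_and => ts; apply: lc; first lra.
    rewrite inE negb_or; apply/andP; split; first by rewrite gt_eqF //; lra.
    by case/orP: ts => //; rewrite negbK => wt; lra.
  - by move=> x; rewrite mem_filter => /andP[_ xs]; apply: jump; rewrite inE xs orbT.
have : F (w + h) - F (w - h) = - N w by apply: J; lra.
rewrite big_cons (bigID (fun x => x < w)) /=.
by move: E1 E2 {IH lc jump sI J far}; lra.
Qed.
End JumpSum.

(** * Identification with the sums of the formula *)

Section Indices.
Variable R : realType.
Implicit Types (u t : R) (x y : R * R).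

Lemma loop_curve (c : R -> R * R) x : generic_closed_curve c ->
  (forall t, c t != x) -> loop (fun t => c t - x).
Proof.
move=> [sm per _ _ _] cx; split => [t|t|t]; last by rewrite subr_eq0.
  by apply: cvgB; [exact: smooth_continuous|exact: cvg_cst].
by rewrite per.
Qed.

Section Shifted.
Variables (c : R -> R * R) (b : R) (C dC : R -> R -> R * R) (u : R).
Hypotheses (gen : generic_closed_curve c) (fC : curve_family C dC).
Hypothesis CE : forall t, C u t = c (b + t).

Lemma range_shift : range (C u) = range c.
Proof.
apply/seteqP; split => _ [t _ <-]; first by exists (b + t).
by exists (t - b) => //; rewrite CE addrC subrK.
Qed.

Lemma wn_curve x : ~ range c x -> wn (fun t => C u t - x) = wn (fun t => c t - x).
Proof.
move=> cx; have lc : loop (fun t => c t - x).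
  by apply: loop_curve => // t; apply/eqP => E; apply: cx; exists t.
by rewrite -(wn_shift b lc); congr wn; apply/funext => t; rewrite CE.
Qed.

Lemma component_shift x : component_of c x = component_of (C u) x.
Proof. by rewrite /component_of range_shift. Qed.

Lemma off_range x : ~ range c x -> forall t, C u t != x.
Proof. by move=> cx t; apply/eqP => E; apply: cx; rewrite -range_shift; exists t. Qed.

(** [ind] selects among the winding numbers around all points of the component; their equality makes
    the selection unambiguous. *)
Lemma ind_component x : ~ range c x ->
  ind (component_of c x) c = wn (fun t => C u t - x).
Proof.
move=> cx.
have wnE y n : component_of c x y -> is_winding_number c y n ->
    n = wn (fun t => C u t - x).
  rewrite component_shift => /(wn_component fC)[y_off <-].
  have cy : ~ range c y.
    by rewrite -range_shift => -[t _ E]; have := y_off t; rewrite E eqxx.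
  rewrite wn_curve // => /is_winding_numberP; apply.
  by apply: loop_curve => // t; apply/eqP => E; apply: cy; exists t.
apply: xget_subset1; last by move=> m n [y [Cy /(wnE _ _ Cy) ->]] [z [Cz /(wnE _ _ Cz) ->]].
exists x; split; first exact: connected_component_refl.
rewrite wn_curve //; apply/is_winding_numberP => //.
by apply: loop_curve => // t; apply/eqP => E; apply: cx; exists t.
Qed.
End Shifted.

Variables (c : R -> R * R) (b : R) (A dA : R -> R -> R * R) (u : R).
Hypotheses (gen : generic_closed_curve c) (base : ~ double_points c (c b)).
Hypothesis AE : forall t, A u t = c (b + t).
Hypothesis dAE : forall t, dA u t = derive1 c (b + t).

(** Both sums are reindexed over [double_points c], from the parameter pairs and from the
    enumeration [p]. Disjointness puts every double point off [c'], where its index is a winding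
    number. *)
Lemma dsum_double_points (c' : R -> R * R) (b' : R) (C dC : R -> R -> R * R)
    (k : nat) (p : 'I_k -> R * R) :
  generic_closed_curve c' -> curve_family C dC -> (forall t, C u t = c' (b' + t)) ->
  double_points c `&` range c' = set0 -> injective p -> range p = double_points c ->
  dsum A dA C u =
    \sum_(j < k) e_sign c (c b) (p j) * ind (component_of c' (p j)) c'.
Proof.
move=> gen' fC CE disj pinj pD.
pose G x := e_sign c (c b) x * ind (component_of c' x) c'.
have bijA := dpair_points gen base AE.
transitivity (\sum_(x \in double_points c) G x).
  rewrite (reindex_fsbig _ _ _ G bijA); apply: eq_fsbigr => z /set_mem zu.
  have zD : double_points c (A u z.1) by case: bijA => h _ _; exact: h.
  have off : ~ range c' (A u z.1).
    by move=> h; have : (set0 : set (R * R)) (A u z.1) by rewrite -disj.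
  rewrite /G (e_sign_dpair gen base AE zu) (ind_component gen' fC CE off).
  by rewrite /dterm !dAE.
have bijp : set_bij [set: 'I_k] (double_points c) p.
  split; first by move=> j _; rewrite -pD; exists j.
    by move=> i j _ _; exact: pinj.
  by rewrite -pD.
rewrite (reindex_fsbig _ _ _ G bijp) (fsbig_seq _ _ (index_enum_uniq 'I_k)).
have -> // : [set` index_enum 'I_k] = [set: 'I_k].
by apply/seteqP; split => // j _ /=; rewrite mem_index_enum.
Qed.
End Indices.

(** Two of the three visits belong to one curve and produce a double point of it on the other. *)
Lemma general_position_no_triple (R : realType) (c : bool -> R -> R * R)
    (b : bool -> R) v :
  general_position (c false) (c true) -> ~ triple_point c b v.
Proof.
move=> [_ d0 d1] tv; have [v0 v2] := triple_point_curves tv.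
have [rng ord pts _] := tv.
have dbl (i j : 'I_3) : (i < j)%N -> (v i).1 = (v j).1 ->
    double_points (c (v i).1) (c (v i).1 (v i).2).
  move=> ij E; have := ord i j ij; rewrite /visit_lt E => -[[->//]|[_ lt]].
  exists (v i).2, (v j).2; split => //; last by rewrite -(pts i j) E.
  have := rng i; have := rng j; rewrite E => /andP[? ?] /andP[? ?].
  move=> /same_param_near E'; suff : (v i).2 = (v j).2 by lra.
  by apply: E'; lra.
have no (X Y : set (R * R)) x : X `&` Y = set0 -> X x -> Y x -> False.
  by move=> XY Xx Yx; have : (set0 : set (R * R)) x by rewrite -XY.
case v1 : (v edge1).1.
  have := dbl edge1 edge2 isT; rewrite v1 v2 => /(_ erefl); apply: (no _ _ _ d1).
  by exists (v edge0).2 => //; have := pts edge0 edge1; rewrite v0 v1.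
have := dbl edge0 edge1 isT; rewrite v0 v1 => /(_ erefl) /(no _ _ _ d0); apply.
by exists (v edge2).2 => //; have := pts edge2 edge0; rewrite v0 v2.
Qed.

Lemma separated_no_triple (R : realType) (c : bool -> R -> R * R)
    (b : bool -> R) v :
  separated_curves (c false) (c true) -> ~ triple_point c b v.
Proof.
move=> [sep _] tv; have [v0 v2] := triple_point_curves tv.
have [_ _ pts _] := tv.
have [|off _] := sep (c false (v edge0).2); first by exists (v edge0).2.
by apply: off; exists (v edge2).2 => //; have := pts edge2 edge0; rewrite v0 v2.
Qed.

Lemma dsum_separated (R : realType) (c c' : R -> R * R) (b b' u : R)
    (A dA C dC : R -> R -> R * R) :
  generic_closed_curve c' -> curve_family C dC ->
  (forall t, A u t = c (b + t)) -> (forall t, C u t = c' (b' + t)) ->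
  (forall x, range c x ->
    (~` range c') x /\ ~ bounded_set (component_of c' x)) ->
  dsum A dA C u = 0.
Proof.
move=> gen fC AE CE sep; apply: fsbig1 => z _.
have [|off unb] := sep (A u z.1); first by exists (b + z.1).
rewrite /dterm (wn_unbounded fC) ?mulr0 //; first exact: (off_range CE).
by rewrite -(component_shift CE).
Qed.

Theorem proposition5p9 (R : realType) (c0 c1 g : R -> R * R)
    (hc0 : generic_closed_curve c0) (hc1 : generic_closed_curve c1)
    (hgp : general_position c0 c1)
    (hg : bridge (two c0 c1) g)
    (hcompat : compatible (two c0 c1) g)
    (k l : nat) (p : 'I_k -> R * R) (q : 'I_l -> R * R)
    (hp : injective p) (hpD : range p = double_points c0)
    (hq : injective q) (hqD : range q = double_points c1)
    (T : int) (hT : is_TSt c0 c1 g T) :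
  T = \sum_(j < k) e_sign c0 (g 0) (p j) * ind (component_of c1 (p j)) c1
    + \sum_(m < l) e_sign c1 (g 1) (q m) * ind (component_of c0 (q m)) c0.
Proof.
have [b0 [b1 [H [b [gb0 gb1 [[hH H0] sep [hb bb0 hbD] fin cross] ->]]]]] := hT.
have base1 : ~ double_points c1 (c1 b1).
  rewrite gb1 => D; have [_ [_ /(_ true) /= E _ _ _]] := hg.
  have : (set0 : set (R * R)) (g 1); last by [].
  by rewrite -E; split => //; exists 1 => //; rewrite /= in_itv /= ler01 lexx.
have I0 : (0 : R) \in `[0, 1] by rewrite in_itv /= lexx ler01.
have I1 : (1 : R) \in `[0, 1] by rewrite in_itv /= lexx ler01.
pose triple u v := triple_point (moving H c1 u) (moving_base b b1 u) v.
pose N u := newborn_sign c1 b1 H b u.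
pose F := crossing_sum H b c1 b1.
(* The possible jump times: finitely many, as general position fails there, and never 0 or 1, by
   general position at the start and separation at the end. *)
pose B := [set u : R | u \in `[0, 1] /\ exists v, triple u v].
have finB : finite_set B.
  apply: sub_finite_set fin => u [uI [v tv]]; split => // gp.
  exact: (general_position_no_triple (c := moving H c1 u) gp tv).
have N0 u : ~ (exists v, triple u v) -> N u = 0.
  by move=> no; apply: xgetPN => e [v [A [tv _ _]]]; apply: no; exists v.
have no0 v : ~ triple 0 v.
  by apply: (general_position_no_triple (c := moving H c1 0)); rewrite /moving /two H0.
have no1 v : ~ triple 1 v.
  exact: (separated_no_triple (c := moving H c1 1) sep).
have A0E' u t : u \in `[0, 1] -> based H b u t = H u (b u + t) := @A0E R H b u t.
have dA0E' u t : u \in `[0, 1] -> dbased H b u t = derive1 (H u) (b u + t) :=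
  @dA0E R H b u t.
have f0 := fa0 hH hb hbD.
pose A1 := based (fun=> c1) (fun=> b1); pose dA1 := dbased (fun=> c1) (fun=> b1).
have f1 : curve_family A1 dA1 := fa1 hc1 base1.
have A1E u t : A1 u t = c1 (b1 + t) by [].
have [gH _ _] := hH.
have F1 : F 1 = 0.
  have [sep0 sep1] := sep.
  have E0 : dsum (based H b) (dbased H b) A1 1 = 0.
    exact: dsum_separated hc1 f1 (fun t => A0E' 1 t I1) (A1E 1) sep0.
  have E1 : dsum A1 dA1 (based H b) 1 = 0.
    exact: dsum_separated (gH 1 I1) f0 (A1E 1) (fun t => A0E' 1 t I1) sep1.
  by rewrite /F /crossing_sum /= [X in X + _]E0 [X in _ + X]E1.
have B01 u : B u -> 0 < u < 1.
  move=> [uI [v tv]].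
  have : u != 0 by apply: contraPneq tv => ->; exact: no0.
  have : u != 1 by apply: contraPneq tv => ->; exact: no1.
  move: uI; rewrite in_itv /= => /andP[u0 u1] n1 n0.
  by rewrite lt_neqAle eq_sym n0 u0 lt_neqAle n1.
have jump u : B u -> exists d : R, 0 < d /\ forall u1 u2,
    u - d < u1 < u -> u < u2 < u + d -> F u2 - F u1 = - N u.
  move=> Bu; have [uI [v tv]] := Bu.
  have ngp : ~ general_position (H u) c1.
    by move=> gp; exact: (general_position_no_triple (c := moving H c1 u) gp tv).
  have [[_ none]|[_ [v0 [tv0 uniq_v trans [A0 crossA]]]]] := cross u uI ngp.
    by have := none v tv.
  (* The set [A] behind the value selected by [xget] may differ from [A0]; the jump is computed with
     this same [A], so only [w] has to be identified with [v0]. *)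
  have [w [A [tw crw NE]]] : [set e : int | exists v A,
      [/\ triple_point (moving H c1 u) (moving_base b b1 u) v,
          triple_crossing (moving H c1) u v A & e = (-1) ^+ #|A|]] (N u).
    by apply: xgetPex; exists ((-1) ^+ #|A0|), v0, A0.
  have wv := uniq_v _ tw; rewrite NE.
  have uniq_w v' : triple u v' -> v' = w by move=> /uniq_v ->.
  have trans_w : transverse_branches (moving H c1 u) w by rewrite wv.
  exact: (crossing_sum_jump hH hb hbD hc1 base1 (B01 u Bu) tw uniq_w trans_w crw).
have [s us sB] : exists2 s : seq R, uniq s & B = [set` s].
  have /finite_seqP[s sE] := finB; exists (undup s); first exact: undup_uniq.
  by rewrite sE; apply/seteqP; split => x /=; rewrite mem_undup.
(* Off [B] the sign is the default 0 of [xget], so the sum over [0, 1] is a finite sum over [B], to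
   which [jump_sum] applies with [F 1 = 0]. *)
have -> : \sum_(u \in `[0, 1]) N u = F 0.
  rewrite -(@fsbig_widen _ _ _ _ B).
  - rewrite sB -fsbig_seq // (@jump_sum R F N 0 1 s) ?F1 ?add0r ?ler01 //.
    + by move=> u us'; apply: B01; rewrite sB.
    + move=> t tI /negP ts.
      have tI' : t \in `[0, 1] by rewrite in_itv.
      apply: (crossing_sum_stable hH hb hbD hc1 base1 tI') => v tv.
      by apply: ts; have : B t by [split => //; exists v]; rewrite sB.
    + by move=> u us'; apply: jump; rewrite sB.
  - by move=> u [].
  - by move=> u [uI nB]; apply: N0 => -[v tv]; apply: nB; split => //; exists v.
have [_ D0 D1] := hgp.
have D1' : double_points c1 `&` range c0 = set0 by rewrite setIC.
have A00 t : based H b 0 t = c0 (b0 + t) by rewrite (A0E' 0 t I0) H0 bb0.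
have dA00 t : dbased H b 0 t = derive1 c0 (b0 + t) by rewrite (dA0E' 0 t I0) H0 bb0.
have base0 : ~ double_points c0 (c0 b0) by rewrite -H0 -bb0; exact: hbD.
have dA1E t : dA1 0 t = derive1 c1 (b1 + t) by exact: erefl.
have S0 := dsum_double_points hc0 base0 A00 dA00 hc1 f1 (A1E 0) D0 hp hpD.
have S1 := dsum_double_points hc1 base1 (A1E 0) dA1E hc0 f0 A00 D1' hq hqD.
by rewrite -gb0 -gb1 -S0 -S1.
Qed.
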